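(* Let $k$ and $c$ be fixed positive integers. There is an algorithm which, given as input any finite simple undirected graph $G$ on $n$ vertices such that every vertex of $G$ belongs to at most $k$ maximal cliques of $G$ and every maximal clique of $G$ contains at most $c$ vertices, computes the multipartite graph $M$ on which the clean-factor series of $G$ terminates in time polynomial in $n$.
   Context: All graphs are finite, undirected and simple. A $p$-partite graph $G=(V_0,\ldots,V_{p-1},E)$ is a graph together with an ordered partition $(V_0,\ldots,V_{p-1})$ of its vertex set into $p$ non-empty parts (levels) such that every edge joins vertices in different parts. $N(x)$ is the neighbourhood of $x$ and $N_i(x)=N(x)\cap V_i$. Factorisation. Given a $p$-partite graph $G=(V_0,\ldots,V_{p-1},E)$ with $p\ge 2$ and a set $V'_p$ of subsets of $V(G)$, the factorisation of $G$ with respect to $V'_p$ is the graph $G'=(V_0,\ldots,V_p,E\cup E_+)$, where the new level $V_p$ is the set of inclusion-maximal elements of $V'_p$ and $E_+=\{Xy \mid X\in V_p,\ y\in X\}$. It is called effective if $V_p\neq\emptyset$. The set $V^+_p$. For a $p$-partite graph, $V^+_p$ is the set of all sets $\{x_1,\ldots,x_l\}\cup\bigcap_{1\le i\le l}N(x_i)$ where $l\ge 2$, $x_1,\ldots,x_l$ are distinct elements of $V_{p-1}$, and $|\bigcap_{1\le i\le l}N(x_i)|\ge 2$. The set $V^*_p$. - If $p\ge 5$: $V^*_p$ is the set of $X\in V^+_p$ such that $|\bigcap_{x\in X\cap V_{p-1}}N_{p-2}(x)|\ge 2$, and $N_{p-3}(x)=N_{p-3}(y)$ for all $x,y\in X\cap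 V_{p-1}$, and $|\bigcap_{x\in X\cap V_{p-1}}N_1(x)|\ge 2$. - If $p=4$: $V^*_4$ is the set of $X\in V^+_4$ such that $|\bigcap_{x\in X\cap V_3}N_2(x)|\ge 2$, $|\bigcap_{x\in X\cap V_3}N_1(x)|\ge 2$, and $N_0(x)=N_0(y)$ for all $x,y\in X\cap V_3$. - If $p=3$: $V^*_3$ is the set of $X\in V^+_3$ such that $|\bigcap_{x\in X\cap V_2}N_1(x)|\ge 2$ and $|\bigcap_{x\in X\cap V_2}N_0(x)|\ge 2$. - If $p=2$: $V^*_2=V^+_2$. The clean-factor graph of a $p$-partite graph is its factorisation with respect to $V^*_p$. Clean-factor series of a graph $G$. $\mathcal{K}(G)$ is the set of maximal cliques of $G$. $G_1=B(G)$ is the vertex-clique-incidence bipartite graph: level $V_0=V(G)$, level $V_1=\mathcal{K}(G)$, with an edge $vC$ whenever $v\in C$. For $i\ge 1$, $G_{i+1}$ is the clean-factor graph of $G_i$ if that factorisation is effective, and is undefined otherwise. The series is always finite; $M$ denotes its last defined graph, i.e. the $G_i$ whose clean-factor factorisation is not effective. *)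

(* Defs.v *)
From mathcomp Require Import all_boot all_algebra.

Set Implicit Arguments.
Unset Strict Implicit.
Unset Printing Implicit Defensive.

(** * Multipartite graphs *)

(** Levels are allowed to be empty, because the factorisation of a graph is
    defined even when it is not effective, in which case its last level is
    empty. *)
Record mpgraph := MPGraph {
  nparts : nat;
  vert :> finType;
  lev : vert -> 'I_nparts;
  adj : rel vert;
  adj_sym : symmetric adj;
  adj_lev : forall u v, adj u v -> lev u != lev v
}.

Section Multipartite.
Variable H : mpgraph.
Implicit Types (x : H) (S : {set H}) (A : {set {set H}}).

Definition part (i : nat) : {set H} := [set x | lev x == i :> nat].
Definition nbrs x : {set H} := [set y | adj x y].
Definition nbrs_in (i : nat) x : {set H} := nbrs x :&: part i.

(** These intersections are only used with [S] nonempty. *)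
Definition cnbrs S : {set H} := \bigcap_(x in S) nbrs x.
Definition cnbrs_in (i : nat) S : {set H} := \bigcap_(x in S) nbrs_in i x.

Definition same_nbrs_in (i : nat) S : bool :=
  [forall x in S, forall y in S, nbrs_in i x == nbrs_in i y].

Definition maximal_sets A : {set {set H}} :=
  [set X in A | [forall Y in A, (X \subset Y) ==> (Y == X)]].

Definition plus_sets : {set {set H}} :=
  [set S :|: cnbrs S | S in powerset (part (nparts H).-1)
                     & (2 <= #|S|) && (2 <= #|cnbrs S|)].

(** The values 0 and 1 of [nparts H] are not meaningful. *)
Definition clean_cond S : bool :=
  match nparts H with
  | 0 | 1 | 2 => true
  | 3 => (2 <= #|cnbrs_in 1 S|) && (2 <= #|cnbrs_in 0 S|)
  | 4 => [&& 2 <= #|cnbrs_in 2 S|, 2 <= #|cnbrs_in 1 S| & same_nbrs_in 0 S]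
  | p => [&& 2 <= #|cnbrs_in (p - 2) S|, same_nbrs_in (p - 3) S
           & 2 <= #|cnbrs_in 1 S|]
  end.

Definition star_sets : {set {set H}} :=
  [set X in plus_sets | clean_cond (X :&: part (nparts H).-1)].

End Multipartite.

(** * Factorisation *)

Section Factorisation.
Variables (H : mpgraph) (A : {set {set H}}).

Definition fvert : finType := (H + {X | X \in maximal_sets A})%type.

Definition flev (u : fvert) : 'I_(nparts H).+1 :=
  match u with
  | inl x => widen_ord (leqnSn _) (lev x)
  | inr _ => ord_max
  end.

Definition fadj : rel fvert := fun u v =>
  match u, v with
  | inl x, inl y => adj x y
  | inl y, inr X | inr X, inl y => y \in val X
  | inr _, inr _ => false
  end.

Lemma fadj_sym : symmetric fadj.
Proof. by case=> [x|X] [y|Y] //=; apply: adj_sym. Qed.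

Lemma fadj_lev u v : fadj u v -> flev u != flev v.
Proof.
case: u v => [x|X] [y|Y] //= uv; rewrite -(inj_eq val_inj) /=.
- by rewrite (inj_eq val_inj) adj_lev.
- by rewrite neq_ltn ltn_ord.
- by rewrite neq_ltn ltn_ord orbT.
Qed.

Definition factorisation : mpgraph := MPGraph fadj_sym fadj_lev.

Definition effective : bool := maximal_sets A != set0.

End Factorisation.

Definition clean_factor (H : mpgraph) : mpgraph := factorisation (star_sets H).

(** * The clean-factor series of a graph [e] on the vertex set [T] *)

Section Series.
Variables (T : finType) (e : rel T).

Definition clique (C : {set T}) : bool :=
  [forall x in C, forall y in C, (x != y) ==> e x y].

Definition max_cliques : {set {set T}} := [set C | maxset clique C].

Definition bvert : finType := (T + {C | C \in max_cliques})%type.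

Definition blev (u : bvert) : 'I_2 :=
  match u with inl _ => ord0 | inr _ => ord_max end.

Definition badj : rel bvert := fun u v =>
  match u, v with
  | inl x, inr C | inr C, inl x => x \in val C
  | _, _ => false
  end.

Lemma badj_sym : symmetric badj.
Proof. by case=> [x|X] [y|Y]. Qed.

Lemma badj_lev u v : badj u v -> blev u != blev v.
Proof. by case: u v => [x|X] [y|Y]. Qed.

Definition clique_incidence : mpgraph := MPGraph badj_sym badj_lev.

(** [clean_series H f]: [H] is a graph of the series and [f] identifies the
    vertices of the input graph with the vertices of level 0 of [H]. *)
Inductive clean_series : forall H : mpgraph, (T -> H) -> Prop :=
| clean_series_init : @clean_series clique_incidence (fun x => inl x)
| clean_series_step (H : mpgraph) (f : T -> H) :
    clean_series f -> effective (star_sets H) ->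
    @clean_series (clean_factor H) (fun x => inl (f x)).

Definition clean_series_end (H : mpgraph) (f : T -> H) : Prop :=
  clean_series f /\ ~~ effective (star_sets H).

End Series.

(** * Model of computation *)

(** The language is a functional presentation of Jones's WHILE language over
    binary trees (Computability and Complexity, MIT Press, 1997).  Trees are
    immutable, so each evaluation step is a bounded number of pointer
    operations: there is no primitive that inspects a whole tree, such as an
    equality test. *)
Inductive tree := Leaf | Node of tree & tree.

Fixpoint tsize (t : tree) : nat :=
  match t with Leaf => 1 | Node a b => (tsize a + tsize b).+1 end.

(** Variables are de Bruijn indices into a list of values.  [ECase a b d]
    evaluates [b] if [a] is [Leaf]; otherwise it evaluates [d] with the head of
    [a] as variable 0 and its tail as variable 1.  [EWhile a b] iterates
    "variable 0 := b" as long as [a] is not [Leaf]; both [a] and [b] see the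
    current value of variable 0, and the result is its final value. *)
Inductive expr :=
| EVar of nat
| ELeaf
| ENode of expr & expr
| ELet of expr & expr
| ECase of expr & expr & expr
| EWhile of expr & expr.

(** [eval env a v t]: in the environment [env], the expression [a] evaluates
    to [v] in [t] steps. *)
Inductive eval : seq tree -> expr -> tree -> nat -> Prop :=
| eval_var env i : i < size env -> eval env (EVar i) (nth Leaf env i) 1
| eval_leaf env : eval env ELeaf Leaf 1
| eval_node env a b u v t1 t2 :
    eval env a u t1 -> eval env b v t2 ->
    eval env (ENode a b) (Node u v) (t1 + t2).+1
| eval_let env a b u v t1 t2 :
    eval env a u t1 -> eval (u :: env) b v t2 ->
    eval env (ELet a b) v (t1 + t2).+1
| eval_case_leaf env a b d v t1 t2 :
    eval env a Leaf t1 -> eval env b v t2 ->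
    eval env (ECase a b d) v (t1 + t2).+1
| eval_case_node env a b d u w v t1 t2 :
    eval env a (Node u w) t1 -> eval (u :: w :: env) d v t2 ->
    eval env (ECase a b d) v (t1 + t2).+1
| eval_while_stop env a b s t :
    eval (s :: env) a Leaf t ->
    eval (s :: env) (EWhile a b) s t.+1
| eval_while_loop env a b s u w s' v t1 t2 t3 :
    eval (s :: env) a (Node u w) t1 -> eval (s :: env) b s' t2 ->
    eval (s' :: env) (EWhile a b) v t3 ->
    eval (s :: env) (EWhile a b) v (t1 + t2 + t3).+1.

(** The running time includes writing out the result in full; otherwise
    sharing of subtrees would allow results of exponential size in polynomial
    time. *)
Definition computes_in (a : expr) (x y : tree) (t : nat) : Prop :=
  exists2 s, eval [:: x] a y s & t = s + tsize y.

(** * Encodings *)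

Definition enc_bool (b : bool) : tree := if b then Node Leaf Leaf else Leaf.
Definition enc_nat (n : nat) : tree := iter n (Node Leaf) Leaf.
Definition enc_list (s : seq tree) : tree := foldr Node Leaf s.

(** Adjacency matrix, with respect to the enumeration [s] of the vertices. *)
Definition enc_rel (T : Type) (e : rel T) (s : seq T) : tree :=
  enc_list [seq enc_list [seq enc_bool (e x y) | y <- s] | x <- s].

Definition enc_graph (n : nat) (e : rel 'I_n) : tree := enc_rel e (enum 'I_n).

(** A multipartite graph is given by its number of levels, the list of the
    levels of its vertices and its adjacency matrix, with respect to an
    enumeration of its vertices which starts with the vertices of the input
    graph, in the order of the input. *)
Definition represents (n : nat) (H : mpgraph) (f : 'I_n -> H) (y : tree) : Prop :=
  exists s : seq H,
    [/\ perm_eq s (enum H), prefix [seq f i | i <- enum 'I_n] s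
      & y = Node (enc_nat (nparts H))
             (Node (enc_list [seq enc_nat (lev v) | v <- s])
                   (enc_rel (@adj H) s))].

(* Main.v *)
Require Import Defs.
From mathcomp Require Import all_boot all_algebra.
From mathcomp Require Import zify.

Set Implicit Arguments.
Unset Strict Implicit.
Unset Printing Implicit Defensive.

(**
  The depth of the series is bounded through [N_1]: two distinct vertices of the
  last level which lie in a common set of the next factorisation have distinct
  [N_1], for otherwise the union of the two maximal sets which define them
  would again be admissible.  As [N_1] of a new vertex is contained in [N_1] of
  each vertex of its set, [#|N_1|] decreases from one level to the next, and
  it is at most [k] at level 2.

  The degrees remain bounded by a constant: a set [X] of the factorisation is
  determined by its trace on the last level, which lies at distance at most 2
  from any vertex of [X].  Hence boundedly many factorisations suffice, each of
  which only has to inspect the sets of boundedly many vertices.  The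
  program is polynomial on all inputs, since it enumerates only the sets of at
  most [D] vertices for constants [D]; the hypotheses on [k] and [c] serve only to
  show that no set is missed.
*)

(** * Polynomially bounded functions *)

Section PolyBounded.
Implicit Types (f g : nat -> nat) (p q : {poly nat}).

Definition poly_bounded f := exists q : {poly nat}, forall n, f n <= (q.[n])%R.

(** Coefficients in [nat] cannot be negative. Monotonicity is what allows a size inside a bound to
    be replaced by an upper bound for it. *)
Lemma horner_nat_mono q m n : m <= n -> (q.[m])%R <= (q.[n])%R.
Proof.
move=> mn; elim/poly_ind: q => [|q a IH]; first by rewrite !horner0.
by rewrite !hornerD !hornerM !hornerX !hornerC leq_add // leq_mul.
Qed.

Lemma poly_bounded_le f g :
  (forall n, f n <= g n) -> poly_bounded g -> poly_bounded f.
Proof. by move=> fg [q gq]; exists q => n; apply: leq_trans (gq n). Qed.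

Lemma poly_bounded_const a : poly_bounded (fun=> a).
Proof. by exists a%:P%R => n; rewrite hornerC. Qed.

Lemma poly_bounded_id : poly_bounded (fun n => n).
Proof. by exists 'X%R => n; rewrite hornerX. Qed.

Lemma poly_bounded_add f g :
  poly_bounded f -> poly_bounded g -> poly_bounded (fun n => f n + g n).
Proof.
move=> [p fp] [q gq]; exists (p + q)%R => n.
by rewrite hornerD; apply: leq_add.
Qed.

Lemma poly_bounded_mul f g :
  poly_bounded f -> poly_bounded g -> poly_bounded (fun n => f n * g n).
Proof.
move=> [p fp] [q gq]; exists (p * q)%R => n.
by rewrite hornerM; apply: leq_mul.
Qed.

Lemma poly_bounded_succ f : poly_bounded f -> poly_bounded (fun n => (f n).+1).
Proof.
move=> pf; apply: (@poly_bounded_le _ (fun n => f n + 1)) => [n|].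
  by rewrite addn1.
exact: poly_bounded_add (poly_bounded_const 1).
Qed.

Lemma poly_bounded_horner p g :
  poly_bounded g -> poly_bounded (fun n => (p.[g n])%R).
Proof.
move=> [q gq]; exists (comp_poly q p) => n.
by rewrite horner_comp horner_nat_mono.
Qed.

End PolyBounded.

Ltac pbound := repeat first
  [ apply: poly_bounded_const | apply: poly_bounded_id
  | apply: poly_bounded_succ | apply: poly_bounded_add
  | apply: poly_bounded_mul | apply: poly_bounded_horner ].

(** * Polynomial-time functions on encodable types *)

(** Canonical instances infer the encodings, so that functions are stated on ordinary types while
    programs only see trees. *)
Structure encType := EncType { enc_sort :> Type; enc : enc_sort -> tree }.
Arguments enc {e} : simpl never.

Canonical tree_encType := EncType (@id tree).
Canonical bool_encType := EncType enc_bool.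
Canonical nat_encType := EncType enc_nat.
Canonical seq_encType (A : encType) :=
  EncType (fun s : seq A => enc_list [seq enc x | x <- s]).
Canonical prod_encType (A B : encType) :=
  EncType (fun p : A * B => Node (enc p.1) (enc p.2)).

Definition esize (A : encType) (x : A) : nat := Defs.tsize (enc x).
Arguments esize {A} : simpl never.

Lemma esize_gt0 (A : encType) (x : A) : 0 < esize x.
Proof. by rewrite /esize; case: (enc x). Qed.

Lemma esize_pair (A B : encType) (x : A) (y : B) :
  esize (x, y) = (esize x + esize y).+1.
Proof. by []. Qed.

Lemma esize_cons (A : encType) (x : A) (s : seq A) :
  esize (x :: s) = (esize x + esize s).+1.
Proof. by []. Qed.

Lemma esize_nil (A : encType) : esize ([::] : seq A) = 1.
Proof. by []. Qed.

Lemma size_esize (A : encType) (s : seq A) : size s < esize s.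
Proof.
elim: s => [|x s IH] //=; rewrite esize_cons !ltnS.
exact: leq_trans (leq_addl _ _).
Qed.

Lemma esize_cat (A : encType) (s1 s2 : seq A) :
  (esize (s1 ++ s2)).+1 = esize s1 + esize s2.
Proof. by elim: s1 => [|x s1 IH] //=; rewrite !esize_cons; lia. Qed.

Lemma esize_catl (A : encType) (s1 s2 : seq A) : esize s1 <= esize (s1 ++ s2).
Proof.
by rewrite -ltnS esize_cat -[X in X < _]addn0 ltn_add2l esize_gt0.
Qed.

Lemma esize_catr (A : encType) (s1 s2 : seq A) : esize s2 <= esize (s1 ++ s2).
Proof.
by rewrite -ltnS esize_cat -[X in X < _]add0n ltn_add2r esize_gt0.
Qed.

Lemma esize_drop (A : encType) k (s : seq A) : esize (drop k s) <= esize s.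
Proof. by rewrite -{2}(cat_take_drop k s) esize_catr. Qed.

Lemma esize_take (A : encType) k (s : seq A) : esize (take k s) <= esize s.
Proof. by rewrite -{2}(cat_take_drop k s) esize_catl. Qed.

(* The environment below the argument is arbitrary, so that an expression
   can be called from any context. *)
Definition runs (A B : encType) (a : expr) (x : A) (y : B) (m : nat) : Prop :=
  forall env, exists2 t, eval (enc x :: env) a (enc y) t & t + esize y <= m.

Definition ptime (A B : encType) (F : A -> B) : Prop :=
  exists (a : expr) (q : {poly nat}), forall x, runs a x (F x) (q.[esize x])%R.

Lemma ptimeI (A B : encType) (F : A -> B) a f : poly_bounded f ->
  (forall x, runs a x (F x) (f (esize x))) -> ptime F.
Proof.
move=> [q fq] aF; exists a, q => x env.
have [t ev le_t] := aF x env.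
by exists t => //; apply: leq_trans (fq _).
Qed.

Lemma eq_ptime (A B : encType) (F G : A -> B) : F =1 G -> ptime F -> ptime G.
Proof. by move=> FG [a [q aF]]; exists a, q => x; rewrite -FG. Qed.

Lemma ptime_id (A : encType) : ptime (fun x : A => x).
Proof.
apply: (@ptimeI _ _ _ (EVar 0) (fun n => 1 + n)) => [|x env]; first by pbound.
by exists 1 => //; apply: (@eval_var (enc x :: env) 0).
Qed.

(** The bound for [F] also covers the size of its result, so the polynomial of [G] is applied to a
    quantity that is polynomial in the input. *)
Lemma ptime_comp (A B C : encType) (F : A -> B) (G : B -> C) :
  ptime F -> ptime G -> ptime (fun x => G (F x)).
Proof.
move=> [a [p aF]] [b [q bG]].
apply: (@ptimeI _ _ _ (ELet a b) (fun n => ((p.[n])%R + (q.[(p.[n])%R])%R).+1)).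
  by pbound.
move=> x env; have [t1 e1 l1] := aF x env.
have [t2 e2 l2] := bG (F x) (enc x :: env).
exists (t1 + t2).+1; first exact: eval_let e1 e2.
rewrite addSn ltnS -addnA leq_add //; first exact: leq_trans (leq_addr _ _) l1.
apply: (leq_trans l2); apply: horner_nat_mono.
exact: leq_trans (leq_addl _ _) l1.
Qed.

Lemma ptime_pair (A B C : encType) (F : A -> B) (G : A -> C) :
  ptime F -> ptime G -> ptime (fun x => (F x, G x)).
Proof.
move=> [a [p aF]] [b [q bG]].
apply: (@ptimeI _ _ _ (ENode a b) (fun n => ((p.[n])%R + (q.[n])%R).+2)).
  by pbound.
move=> x env; have [t1 e1 l1] := aF x env; have [t2 e2 l2] := bG x env.
exists (t1 + t2).+1; first exact: eval_node e1 e2.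
by rewrite esize_pair addSn addnS !ltnS addnACA leq_add.
Qed.

(** A nonempty list and the pair of its head and tail have the same encoding, so the pairing program
    serves unchanged. *)
Lemma ptime_cons (A B : encType) (F : A -> B) (G : A -> seq B) :
  ptime F -> ptime G -> ptime (fun x => F x :: G x).
Proof. by move=> pF pG; have [a [q h]] := ptime_pair pF pG; exists a, q. Qed.

Lemma ptime_fst (A B C : encType) (F : A -> B * C) :
  ptime F -> ptime (fun x => (F x).1).
Proof.
move=> [a [p aF]].
apply: (@ptimeI _ _ _ (ECase a ELeaf (EVar 0)) (fun n => ((p.[n])%R + 1).+1)).
  by pbound.
move=> x env; have [t1 e1 l1] := aF x env; exists (t1 + 1).+1.
  apply: eval_case_node e1 _.
  exact: (@eval_var [:: enc (F x).1, enc (F x).2, enc x & env] 0).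
rewrite addSn ltnS addnAC leq_add2r (leq_trans _ l1) // leq_add2l.
by case: (F x) => u v; rewrite esize_pair (leq_trans (leq_addr _ _) (leqnSn _)).
Qed.

Lemma ptime_snd (A B C : encType) (F : A -> B * C) :
  ptime F -> ptime (fun x => (F x).2).
Proof.
move=> [a [p aF]].
apply: (@ptimeI _ _ _ (ECase a ELeaf (EVar 1)) (fun n => ((p.[n])%R + 1).+1)).
  by pbound.
move=> x env; have [t1 e1 l1] := aF x env; exists (t1 + 1).+1.
  apply: eval_case_node e1 _.
  exact: (@eval_var [:: enc (F x).1, enc (F x).2, enc x & env] 1).
rewrite addSn ltnS addnAC leq_add2r (leq_trans _ l1) // leq_add2l.
by case: (F x) => u v; rewrite esize_pair (leq_trans (leq_addl _ _) (leqnSn _)).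
Qed.

Lemma ptime_if (A B : encType) (P : A -> bool) (F G : A -> B) :
  ptime P -> ptime F -> ptime G -> ptime (fun x => if P x then F x else G x).
Proof.
move=> [c [r cP]] [a [p aF]] [b [q bG]].
(* [true] is a node, so [F] belongs in the third branch. There the case split has pushed two values,
   and the argument is found at index 2; the [ELet] brings it back to index 0. *)
apply: (@ptimeI _ _ _ (ECase c b (ELet (EVar 2) a))
  (fun n => ((r.[n])%R + ((p.[n])%R + (q.[n])%R)).+3)); first by pbound.
move=> x env; have [t0 e0 l0] := cP x env.
move: e0; case: (P x) => e0.
  have [t1 e1 l1] := aF x [:: Leaf, Leaf, enc x & env].
  exists (t0 + (1 + t1).+1).+1.
    apply: eval_case_node e0 _; apply: eval_let e1.
    exact: (@eval_var [:: Leaf, Leaf, enc x & env] 2).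
  rewrite !add1n !addnS !addSn !ltnS -addnA leq_add //.
    exact: leq_trans (leq_addr _ _) l0.
  exact: leq_trans l1 (leq_addr _ _).
have [t1 e1 l1] := bG x env.
exists (t0 + t1).+1; first exact: eval_case_leaf e0 e1.
rewrite addSn -addnA ltnS; apply: (leq_trans _ (leqnSn _)).
apply: (leq_trans _ (leqnSn _)).
rewrite leq_add // ?(leq_trans l1) ?leq_addl //.
exact: leq_trans (leq_addr _ _) l0.
Qed.

Fixpoint tree_expr (t : tree) : expr :=
  if t is Node u v then ENode (tree_expr u) (tree_expr v) else ELeaf.

Lemma ptime_const (A B : encType) (y : B) : ptime (fun _ : A => y).
Proof.
have [t ht] : exists t, forall env, eval env (tree_expr (enc y)) (enc y) t.
  elim: (enc y) => [|u [t1 h1] v [t2 h2]].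
    by exists 1 => env; apply: eval_leaf.
  by exists (t1 + t2).+1 => env; apply: eval_node.
apply: (@ptimeI _ _ _ (tree_expr (enc y)) (fun=> t + esize y)).
  exact: poly_bounded_const.
by move=> x env; exists t.
Qed.

Lemma ptime_is_cons (A B : encType) (F : A -> seq B) :
  ptime F -> ptime (fun x => size (F x) > 0).
Proof.
move=> [a [p aF]].
apply: (@ptimeI _ _ _ (ECase a ELeaf (ENode ELeaf ELeaf))
          (fun n => ((p.[n])%R + 7))); first by pbound.
move=> x env; have [t1 e1 l1] := aF x env.
case: (F x) e1 l1 => [|y l] e1 l1.
  exists (t1 + 1).+1; first exact: eval_case_leaf e1 (eval_leaf _).
  rewrite /esize /= addn1 addnS addn0 -addn3 leq_add //.
  exact: leq_trans (leq_addr _ _) l1.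
exists (t1 + 3).+1.
  by apply: eval_case_node e1 _; apply: (eval_node (eval_leaf _) (eval_leaf _)).
rewrite /esize /= -addSn -addnA -addSnnS; apply: leq_add => //.
by rewrite (leq_trans _ l1) // -addn1 leq_add2l.
Qed.

(** * Loops *)

Section Foldl.
Variables X Y Z : encType.
Variables (f : X -> Z -> Y -> Z) (z : X -> Z) (l : X -> seq Y).

(** The state is always a node whose head is the list still to be processed, so the loop stops
    exactly when that list is empty. *)
Definition loop_test := ECase (EVar 0) ELeaf (EVar 0).
(** After the three case splits, variables 0 to 3 hold the accumulator, the parameter, the current
    element and the rest of the list. *)
Definition loop_body (b : expr) :=
  ECase (EVar 0) ELeaf
    (ECase (EVar 0) ELeaf
      (ECase (EVar 3) ELeaf
        (ENode (EVar 3)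
          (ENode (ELet (ENode (EVar 1) (ENode (EVar 0) (EVar 2))) b)
                 (EVar 1))))).
Definition loop_expr (zx lx b : expr) :=
  ELet (ENode lx (ENode zx (EVar 0)))
    (ECase (EWhile loop_test (loop_body b)) ELeaf
      (ECase (EVar 1) ELeaf (EVar 0))).

Definition loop_state (x : X) (u : Z) (s : seq Y) : tree :=
  Node (enc s) (Node (enc u) (enc x)).

(** The bound [m] is required only for the accumulators that actually occur. The 20 absorbs the
    fixed cost of an iteration, and the 4 is the cost of the final test together with leaving the
    loop. *)
Lemma eval_loop b x m s u env :
  (forall k y, k < size s -> runs b (x, (foldl (f x) u (take k s), nth y s k))
     (f x (foldl (f x) u (take k s)) (nth y s k)) m) ->
  exists2 t, eval (loop_state x u s :: env) (EWhile loop_test (loop_body b))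
                  (loop_state x (foldl (f x) u s) [::]) t
           & t <= size s * (m + 20) + 4.
Proof.
elim: s u => [|y s IH] u hb /=.
  exists 4 => //; apply: (@eval_while_stop _ _ _ _ 3).
  rewrite /loop_test; apply: (@eval_case_node _ _ _ _ _ _ _ 1 1).
    exact: (@eval_var (loop_state x u [::] :: env) 0).
  exact: (@eval_var [:: Leaf, _ & _] 0).
have [t2 e2 l2] := hb 0 y isT
  [:: enc u, enc x, enc y, enc s, enc (y :: s), Node (enc u) (enc x),
      loop_state x u (y :: s) & env].
have [t3 e3 l3] := IH (f x u y) (fun k y' lt => hb k.+1 y' lt).
eexists.
  apply: eval_while_loop e3.
    rewrite /loop_test; apply: (@eval_case_node _ _ _ _ _ _ _ 1 1).
      exact: (@eval_var (loop_state x u (y :: s) :: env) 0).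
    exact: (@eval_var [:: enc (y :: s), _ & _] 0).
  rewrite /loop_body; apply: eval_case_node.
    exact: (@eval_var (loop_state x u (y :: s) :: env) 0).
  apply: eval_case_node; first exact: (@eval_var [:: enc (y :: s), _ & _] 0).
  apply: eval_case_node.
    exact: (@eval_var [:: _, _, _, Node (enc u) (enc x) & _] 3).
  apply: eval_node; first exact: (@eval_var [:: _, _, _, enc s & _] 3).
  apply: eval_node; last exact: (@eval_var [:: _, enc x & _] 1).
  apply: eval_let; last exact: e2.
  apply: eval_node; first exact: (@eval_var [:: _, enc x & _] 1).
  apply: eval_node; first exact: (@eval_var [:: enc u & _] 0).
  exact: (@eval_var [:: _, _, enc y & _] 2).
have {}l2 : t2 <= m by apply: leq_trans l2; apply: leq_addr.
rewrite mulSn; move: l3; move: (_ * _)%N => u3 l3; lia.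
Qed.

(** A polynomial-time body does not suffice, since iterating it may square the accumulator each
    time; hence the separate bound [g] on the accumulators of all prefixes. *)
Lemma ptime_foldl g : poly_bounded g ->
  (forall x k, esize (foldl (f x) (z x) (take k (l x))) <= g (esize x)) ->
  ptime (fun p : X * (Z * Y) => f p.1 p.2.1 p.2.2) -> ptime z -> ptime l ->
  ptime (fun x => foldl (f x) (z x) (l x)).
Proof.
move=> pg zg [b [q bf]] [zx [qz hz]] [lx [ql hl]].
(* The input of the body is a triple: the parameter, an accumulator bounded by [g], and an element
   no larger than the whole list. *)
pose m n := (q.[(n + (g n + (ql.[n])%R).+1).+1])%R.
apply: (@ptimeI _ _ _ (loop_expr zx lx b) (fun n => 
  (ql.[n])%R + (qz.[n])%R + ((ql.[n])%R * (m n + 20)) + 20 + g n)).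
  by case: pg => qg gq; do ?[pbound; try by exists qg].
move=> x env; have [t1 e1 l1] := hl x env; have [t2 e2 l2] := hz x env.
have l1' : esize (l x) <= (ql.[esize x])%R by apply: leq_trans l1; apply: leq_addl.
have hb k y : k < size (l x) ->
    runs b (x, (foldl (f x) (z x) (take k (l x)), nth y (l x) k))
     (f x (foldl (f x) (z x) (take k (l x))) (nth y (l x) k)) (m (esize x)).
  move=> ltk env'.
  have [t e le] := bf (x, (foldl (f x) (z x) (take k (l x)), nth y (l x) k)) env'.
  exists t => //; apply: (leq_trans le); apply: horner_nat_mono.
  rewrite !esize_pair ltnS leq_add2l ltnS leq_add // (leq_trans _ l1') //.
  apply: leq_trans (esize_drop k _).
  by rewrite (drop_nth y ltk) esize_cons ltnW // ltnS leq_addr.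
have [t3 e3 l3] := eval_loop (enc x :: env) hb.
eexists.
  apply: eval_let.
    apply: eval_node; first exact: e1.
    apply: eval_node; first exact: e2.
    exact: (@eval_var [:: enc x & _] 0).
  apply: eval_case_node; first exact: e3.
  apply: eval_case_node.
    exact: (@eval_var [:: Leaf, Node (enc (foldl (f x) (z x) (l x))) (enc x) & _] 1).
  exact: (@eval_var [:: enc (foldl (f x) (z x) (l x)) & _] 0).
have lg : esize (foldl (f x) (z x) (l x)) <= g (esize x).
  by rewrite -{1}(take_size (l x)).
have {}l1 : t1 <= (ql.[esize x])%R by apply: leq_trans l1; apply: leq_addr.
have {}l2 : t2 <= (qz.[esize x])%R by apply: leq_trans l2; apply: leq_addr.
rewrite leq_add //.
have {}l3 : t3 <= (ql.[esize x])%R * (m (esize x) + 20) + 4.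
  apply: (leq_trans l3); rewrite leq_add2r leq_mul2r; apply/orP; right.
  by apply: leq_trans l1'; rewrite ltnW // size_esize.
move: l1 l2 l3; set u1 := (ql.[_])%R; set u2 := (qz.[_])%R.
move: u1 u2 (u1 * _) => /= u1 u2 u3; lia.
Qed.

End Foldl.

(** * Closure of polynomial time under list and boolean operations *)

Lemma ptime_comp2 (A B C D : encType) (f : B -> C -> D) (a : A -> B) (b : A -> C) :
  ptime (fun p : B * C => f p.1 p.2) -> ptime a -> ptime b ->
  ptime (fun x => f (a x) (b x)).
Proof. by move=> pf pa pb; exact: (ptime_comp (ptime_pair pa pb) pf). Qed.

Lemma ptime_esize (A B : encType) (F : A -> B) :
  ptime F -> exists q : {poly nat}, forall x, esize (F x) <= (q.[esize x])%R.
Proof.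
move=> [a [q aF]]; exists q => x; have [t _ le] := aF x [::].
exact: leq_trans (leq_addl _ _) le.
Qed.

Lemma esize_rev (A : encType) (s : seq A) : esize (rev s) = esize s.
Proof.
elim: s => // y s IH; rewrite rev_cons -cats1.
by have := esize_cat (rev s) [:: y]; rewrite IH !esize_cons esize_nil; lia.
Qed.

Lemma ptime_rev (X Y : encType) (l : X -> seq Y) :
  ptime l -> ptime (fun x => rev (l x)).
Proof.
move=> pl; have [q ql] := ptime_esize pl.
have revE (s : seq Y) : rev s = foldl (fun u y => y :: u) [::] s.
  by rewrite /rev; elim: s [::] => //= y s IH u; rewrite IH.
apply: (eq_ptime (F := fun x => foldl (fun u y => y :: u) [::] (l x))) => [x|].
  by rewrite revE.
apply: (@ptime_foldl X Y (seq_encType Y) (fun _ u y => y :: u) (fun=> [::]) l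
          (fun n => (q.[n])%R)) => //; first by pbound.
- by move=> x k; rewrite -revE esize_rev (leq_trans (esize_take _ _)).
- apply: ptime_cons; first by do 2!apply: ptime_snd; apply: ptime_id.
  by apply: ptime_fst; apply: ptime_snd; apply: ptime_id.
- exact: ptime_const.
Qed.

(** A right fold is a left fold over the reversed list, and its accumulators are the folds of the
    suffixes. *)
Lemma ptime_foldr (X Y Z : encType) (f : X -> Y -> Z -> Z) (z : X -> Z)
    (l : X -> seq Y) g : poly_bounded g ->
  (forall x k, esize (foldr (f x) (z x) (drop k (l x))) <= g (esize x)) ->
  ptime (fun p : X * (Y * Z) => f p.1 p.2.1 p.2.2) -> ptime z -> ptime l ->
  ptime (fun x => foldr (f x) (z x) (l x)).
Proof.
move=> pg hg pf pz pl.
apply: (eq_ptime (F := fun x => foldl (fun u y => f x y u) (z x) (rev (l x)))).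
  by move=> x; rewrite foldl_rev.
apply: (ptime_foldl pg) => // [x k||].
- by rewrite take_rev foldl_rev.
- apply: (ptime_comp (F := fun p : X * (Z * Y) => (p.1, (p.2.2, p.2.1))) _ pf).
  apply: ptime_pair; first by apply: ptime_fst; apply: ptime_id.
  by apply: ptime_pair; [apply: ptime_snd|apply: ptime_fst]; apply: ptime_snd;
     apply: ptime_id.
- exact: ptime_rev.
Qed.

Lemma ptime_map (X Y Z : encType) (f : X -> Y -> Z) (l : X -> seq Y) :
  ptime (fun p : X * Y => f p.1 p.2) -> ptime l ->
  ptime (fun x => [seq f x y | y <- l x]).
Proof.
move=> pf pl; have [q ql] := ptime_esize pl; have [r rf] := ptime_esize pf.
apply: (eq_ptime (F := fun x => foldr (fun y u => f x y :: u) [::] (l x))) => [x|].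
  by elim: (l x) => //= y s ->.
(* There are at most [q] results, and [r] bounds each of them in terms of the parameter and one
   element of the list. *)
apply: (@ptime_foldr X Y (seq_encType Z) (fun x y u => f x y :: u) (fun=> [::]) l
  (fun n => (q.[n])%R * (1 + (r.[(n + (q.[n])%R).+1])%R) + 1)) => //; first by pbound.
- move=> x k; have := leq_trans (esize_drop k _) (ql x).
  move: (drop k _) => s {k}; move: (q.[_])%R => m sm.
  have {sm} : size s + esize s <= m + esize s /\ esize s <= m.
    by rewrite leq_add2r; split=> //; apply: leq_trans sm; apply: ltnW (size_esize _).
  case; rewrite leq_add2r => szm sm.
  suff: esize (foldr (fun y u => f x y :: u) [::] s)
      <= size s * (1 + (r.[(esize x + m).+1])%R) + 1.
    move/leq_trans; apply; rewrite leq_add2r leq_mul2r szm orbT //.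
  elim: s sm {szm} => [|y s IH] //=; rewrite !esize_cons => sm.
  rewrite mulSn -addSn -[X in _ <= X]addnA leq_add ?IH ?add1n ?ltnS //; last by lia.
  by apply: leq_trans (rf (x, y)) _; apply: horner_nat_mono; rewrite esize_pair; lia.
- apply: ptime_cons; last by do 2!apply: ptime_snd; apply: ptime_id.
  apply: (ptime_comp (F := fun p : X * (Y * seq Z) => (p.1, p.2.1)) _ pf).
  apply: ptime_pair; first by apply: ptime_fst; apply: ptime_id.
  by apply: ptime_fst; apply: ptime_snd; apply: ptime_id.
- exact: ptime_const.
Qed.

(** For folds whose result is at most as large as list and start value together, this spares the
    choice of a bound on the accumulators. *)
Lemma ptime_foldr_le (X Y Z : encType) (f : X -> Y -> Z -> Z) (z : Z)
    (l : X -> seq Y) :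
  (forall x s, esize (foldr (f x) z s) <= esize s + esize z) ->
  ptime (fun p : X * (Y * Z) => f p.1 p.2.1 p.2.2) -> ptime l ->
  ptime (fun x => foldr (f x) z (l x)).
Proof.
move=> fz pf pl; have [q ql] := ptime_esize pl.
apply: (@ptime_foldr _ _ _ f (fun=> z) l (fun n => (q.[n])%R + esize z)) => //.
- by pbound.
- move=> x k; apply: leq_trans (fz x _) _.
  by rewrite leq_add2r (leq_trans (esize_drop _ _)).
- exact: ptime_const.
Qed.

Ltac ptime_proj := first
  [ exact: ptime_id
  | by apply: ptime_fst; ptime_proj
  | by apply: ptime_snd; ptime_proj
  | by apply: ptime_pair; ptime_proj
  | by apply: ptime_cons; ptime_proj
  | exact: ptime_const ].

Lemma ptime_filter (X Y : encType) (P : X -> Y -> bool) (l : X -> seq Y) :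
  ptime (fun p : X * Y => P p.1 p.2) -> ptime l ->
  ptime (fun x => [seq y <- l x | P x y]).
Proof.
move=> pP pl.
apply: (@ptime_foldr_le X Y (seq_encType Y)
          (fun x y u => if P x y then y :: u else u)) => //.
- move=> x s; rewrite -/(filter _ s); elim: s => //= y s IH.
  by case: ifP => _; rewrite !esize_cons; lia.
- apply: ptime_if; try ptime_proj.
  by apply: ptime_comp2 pP _ _; ptime_proj.
Qed.

Lemma ptime_all (X Y : encType) (P : X -> Y -> bool) (l : X -> seq Y) :
  ptime (fun p : X * Y => P p.1 p.2) -> ptime l ->
  ptime (fun x => all (P x) (l x)).
Proof.
move=> pP pl.
apply: (eq_ptime (F := fun x =>
          foldr (fun y b => if P x y then b else false) true (l x))).
  by move=> x; elim: (l x) => //= y s ->.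
apply: ptime_foldr_le => //.
(* The encoding of [true] has size 3, the larger of the two booleans. *)
- move=> x s; apply: (@leq_trans 3); last exact: leq_addl.
  by case: (foldr _ _ _).
- apply: ptime_if; try ptime_proj.
  by apply: ptime_comp2 pP _ _; ptime_proj.
Qed.

Lemma ptime_cat (X Y : encType) (l1 l2 : X -> seq Y) :
  ptime l1 -> ptime l2 -> ptime (fun x => l1 x ++ l2 x).
Proof.
move=> p1 p2; have [q1 h1] := ptime_esize p1; have [q2 h2] := ptime_esize p2.
have catE (s t : seq Y) : foldr cons t s = s ++ t by elim: s => //= y s ->.
apply: (eq_ptime (fun x => catE (l1 x) (l2 x))).
apply: (@ptime_foldr X Y (seq_encType Y) (fun _ => cons) l2 l1
  (fun n => (q1.[n])%R + (q2.[n])%R)) => //; try ptime_proj.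
  by pbound.
move=> x k; rewrite catE ltnW // esize_cat leq_add //.
exact: leq_trans (esize_drop _ _) _.
Qed.

Lemma ptime_flatten (X Y : encType) (l : X -> seq (seq Y)) :
  ptime l -> ptime (fun x => flatten (l x)).
Proof.
move=> pl; apply: ptime_foldr_le => //.
- move=> _ s; rewrite -/(flatten s); elim: s => //= y s IH.
  by have := esize_cat y (flatten s); rewrite !esize_cons; lia.
- by apply: ptime_cat; ptime_proj.
Qed.

Lemma ptime_head (A B : encType) (y0 : B) (F : A -> seq B) :
  ptime F -> ptime (fun x => head y0 (F x)).
Proof.
move=> [a [p aF]]; have [b [q bG]] := ptime_const A y0.
apply: (@ptimeI _ _ _ (ECase a b (EVar 0)) (fun n => ((p.[n])%R + (q.[n])%R).+2)).
  by pbound.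
move=> x env; have [t1 e1 l1] := aF x env; have [t2 e2 l2] := bG x env.
case: (F x) e1 l1 => [|y s] e1; rewrite ?esize_cons => l1.
  by exists (t1 + t2).+1; [apply: eval_case_leaf e1 e2|rewrite /=; lia].
exists (t1 + 1).+1; last by rewrite /=; lia.
by apply: eval_case_node e1 _; apply: (@eval_var [:: enc y & _] 0).
Qed.

Lemma ptime_behead (A B : encType) (F : A -> seq B) :
  ptime F -> ptime (fun x => behead (F x)).
Proof.
move=> [a [p aF]].
apply: (@ptimeI _ _ _ (ECase a ELeaf (EVar 1)) (fun n => (p.[n])%R.+3)).
  by pbound.
move=> x env; have [t1 e1 l1] := aF x env.
case: (F x) e1 l1 => [|y s] e1; rewrite ?esize_cons => l1.
  exists (t1 + 1).+1; first exact: eval_case_leaf e1 (eval_leaf _).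
  by move: l1; rewrite /= !esize_nil; lia.
exists (t1 + 1).+1; last by rewrite /=; lia.
by apply: eval_case_node e1 _; apply: (@eval_var [:: _, enc s & _] 1).
Qed.

(** The fold runs over the first list and consumes the second one inside its accumulator. The
    default [z0] only completes [head], which is taken after a test that the list is nonempty. *)
Lemma ptime_zip (X Y Z : encType) (z0 : Z) (l : X -> seq Y) (m : X -> seq Z) :
  ptime l -> ptime m -> ptime (fun x => zip (l x) (m x)).
Proof.
move=> pl pm; have [q hq] := ptime_esize pl; have [r hr] := ptime_esize pm.
pose f (_ : X) (w : seq (Y * Z) * seq Z) y :=
  if 0 < size w.2 then ((y, head z0 w.2) :: w.1, behead w.2) else w.
have fE x u s t : foldl (f x) (u, t) s = (catrev (zip s t) u, drop (size s) t).
  elim: s u t => [|y s IH] u [|z t] //=; rewrite ?IH //=.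
  by case: s {IH}.
apply: (eq_ptime (F := fun x => rev (foldl (f x) ([::], m x) (l x)).1)) => [x|].
  by rewrite fE /= -/(rev _) revK.
apply: ptime_rev; apply: ptime_fst.
apply: (@ptime_foldl X Y (prod_encType _ _) f _ l
  (fun n => ((q.[n])%R + (r.[n])%R + (r.[n])%R).+1)) => //.
- by pbound.
- move=> x k; rewrite fE esize_pair /= -/(rev _) esize_rev ltnS.
  have ezip (s : seq Y) (t : seq Z) : esize (zip s t) <= esize s + esize t.
    elim: s t => [|y s IH] [|z t] //; rewrite ?leq_addl ?leq_addr //.
    by rewrite /= !esize_cons esize_pair; have := IH t; lia.
  apply: leq_add; last by rewrite (leq_trans (esize_drop _ _)).
  apply: (leq_trans (ezip _ _)); rewrite leq_add //.
  exact: leq_trans (esize_take _ _) _.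
- apply: ptime_if; last by ptime_proj.
    by apply: ptime_is_cons; ptime_proj.
  apply: ptime_pair; last by apply: ptime_behead; ptime_proj.
  apply: ptime_cons; last by ptime_proj.
  by apply: ptime_pair; [ptime_proj|apply: ptime_head; ptime_proj].
- by apply: ptime_pair => //; ptime_proj.
Qed.

Lemma ptime_has (X Y : encType) (P : X -> Y -> bool) (l : X -> seq Y) :
  ptime (fun p : X * Y => P p.1 p.2) -> ptime l ->
  ptime (fun x => has (P x) (l x)).
Proof.
move=> pP pl.
apply: (eq_ptime (F := fun x => 0 < size [seq y <- l x | P x y])).
  by move=> x; rewrite size_filter has_count.
by apply: ptime_is_cons; apply: ptime_filter.
Qed.

Lemma ptime_neg (X : encType) (P : X -> bool) :
  ptime P -> ptime (fun x => ~~ P x).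
Proof. by move=> pP; apply: ptime_if => //; ptime_proj. Qed.

Lemma ptime_and (X : encType) (P Q : X -> bool) :
  ptime P -> ptime Q -> ptime (fun x => P x && Q x).
Proof. by move=> pP pQ; apply: ptime_if => //; ptime_proj. Qed.

Lemma ptime_or (X : encType) (P Q : X -> bool) :
  ptime P -> ptime Q -> ptime (fun x => P x || Q x).
Proof. by move=> pP pQ; apply: ptime_if => //; ptime_proj. Qed.

Lemma ptime_imply (X : encType) (P Q : X -> bool) :
  ptime P -> ptime Q -> ptime (fun x => P x ==> Q x).
Proof. by move=> pP pQ; apply: ptime_if => //; ptime_proj. Qed.

(** A number is encoded like a list of leaves. As [i] is a constant of the program, the comparison
    unfolds into [i] tails and emptiness tests, without a loop. *)
Lemma ptime_eqnat (X : encType) (F : X -> nat) (i : nat) :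
  ptime F -> ptime (fun x => F x == i).
Proof.
move=> [a [q aF]].
have pF : ptime (fun x => nseq (F x) Leaf).
  exists a, q => x env; have [t e le] := aF x env.
  have enc_nseq : enc (nseq (F x) Leaf) = enc (F x).
    by rewrite /enc /= map_nseq; elim: (F x) => //= m ->.
  by exists t; rewrite /esize enc_nseq.
suff sizeE (G : X -> seq tree) : ptime G -> ptime (fun x => size (G x) == i).
  by have := sizeE _ pF; apply: eq_ptime => x; rewrite size_nseq.
elim: i G {F pF a q aF} => [|i IH] G pG.
  apply: (eq_ptime (F := fun x => ~~ (0 < size (G x)))) => [x|].
    by case: (G x).
  by apply: ptime_neg; apply: ptime_is_cons.
apply: (eq_ptime (F := fun x =>
          if 0 < size (G x) then size (behead (G x)) == i else false)) => [x|].
  by case: (G x).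
apply: ptime_if; [exact: ptime_is_cons| |exact: ptime_const].
by apply: IH; apply: ptime_behead.
Qed.

Lemma ptime_size_ge2 (X Y : encType) (F : X -> seq Y) :
  ptime F -> ptime (fun x => 2 <= size (F x)).
Proof.
move=> pF.
apply: (eq_ptime (F := fun x => 0 < size (behead (F x)))) => [x|].
  by rewrite size_behead; case: (size _).
by apply: ptime_is_cons; apply: ptime_behead.
Qed.

(** * The algorithm *)

(* A set of vertices is a bit vector, and a multipartite graph is the list of
   its vertices, each with its level and its row of the adjacency matrix. *)

Definition subv (X Y : seq bool) := all (fun b => b.1 ==> b.2) (zip X Y).
Definition disjv (X Y : seq bool) := all (fun b => ~~ (b.1 && b.2)) (zip X Y).
Definition orv (X Y : seq bool) := [seq b.1 || b.2 | b <- zip X Y].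
Definition zerov A (l : seq A) : seq bool := [seq false | _ <- l].
(** Only the length of [l] matters. Vertices are handled as unit vectors, so no index arithmetic is
    ever programmed. *)
Definition unitv A (l : seq A) : seq (seq bool) :=
  foldr (fun _ u => (true :: zerov u) :: [seq false :: r | r <- u]) [::] l.

(** For fixed [d] the list has polynomial length, namely the [d]-th power of the length of [U] plus
    one. Repetitions are tolerated and removed later by [dedupv]. *)
Fixpoint unionsv d (U : seq (seq bool)) (z : seq bool) : seq (seq bool) :=
  if d is d'.+1 then
    flatten [seq [seq orv W u | u <- U] | W <- unionsv d' U z] ++ unionsv d' U z
  else [:: z].

(** Comparing by mutual inclusion instead of equality keeps equal copies from eliminating each
    other. *)
Definition maxv (L : seq (seq bool)) :=
  [seq X <- L | all (fun Y => subv X Y ==> subv Y X) L].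
Definition dedupv (L : seq (seq bool)) :=
  foldr (fun X u => if has (fun Y => subv X Y && subv Y X) u then u else X :: u)
    [::] L.

Notation mpstate := (seq (nat * seq bool)).
Implicit Types st : mpstate.

(** By symmetry of adjacency, the common neighbours of [W] are the vertices whose row contains [W],
    so no intersection of rows has to be formed. *)
Definition cnbrs_ge2 i W st :=
  2 <= size [seq v <- st | (v.1 == i) && subv W v.2].
(** The members of [W] have equal neighbourhoods in level [i] exactly when each vertex of that level
    is adjacent to all of [W] or to none of it. *)
Definition same_nbrsv i W st :=
  all (fun v => (v.1 == i) ==> (subv W v.2 || disjv W v.2)) st.

Definition clean_condv p st W : bool :=
  match p with
  | 0 | 1 | 2 => true
  | 3 => cnbrs_ge2 1 W st && cnbrs_ge2 0 W st
  | 4 => [&& cnbrs_ge2 2 W st, cnbrs_ge2 1 W st & same_nbrsv 0 W st]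
  | _ => [&& cnbrs_ge2 (p - 2) W st, same_nbrsv (p - 3) W st & cnbrs_ge2 1 W st]
  end.

Definition in_levelv i st (W : seq bool) :=
  all (fun b => b.1 ==> (b.2.1 == i)) (zip W st).

Definition goodv p st W :=
  [&& in_levelv p.-1 st W, 2 <= size [seq b <- W | b],
      2 <= size [seq v <- st | subv W v.2] & clean_condv p st W].

Definition closev st W := orv W [seq subv W v.2 | v <- st].

Definition newv p d st : seq (seq bool) :=
  dedupv (maxv
    [seq closev st W | W <- unionsv d (unitv st) (zerov st) & goodv p st W]).

Definition extendv p st (new : seq (seq bool)) : mpstate :=
  [seq (b.2.1, b.2.2 ++ [seq ~~ disjv b.1 X | X <- new]) | b <- zip (unitv st) st]
  ++ [seq (p, X ++ zerov new) | X <- new].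

Definition outv (p : nat) st : nat * (seq nat * seq (seq bool)) :=
  (p, ([seq v.1 | v <- st], [seq v.2 | v <- st])).

(** A new vertex has at most [d + d] neighbours. An old one has at most [d] old neighbours, and its
    new ones are counted by subsets of a neighbourhood of size [d + d * d]. The sum covers both
    cases. *)
Definition next_degree d := d + d + 2 ^ (d + d * d).

Fixpoint runv fuel p d st :=
  if fuel is fuel'.+1 then
    if 0 < size (newv p d st) then
      runv fuel' p.+1 (next_degree d) (extendv p st (newv p d st))
    else outv p st
  else outv p st.

(** Joining the unit vector to each row makes adjacency reflexive, which replaces the side condition
    [x != y] of a clique. *)
Definition cliquev (R : seq (seq bool)) (W : seq bool) :=
  all (fun b => b.1 ==> subv W (orv b.2.1 b.2.2)) (zip W (zip R (unitv R))).

Definition cliquesv c (R : seq (seq bool)) :=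
  dedupv (maxv [seq W <- unionsv c (unitv R) (zerov R) | cliquev R W]).

(** The clique-incidence graph arises in the same way as a factorisation: the edgeless graph on
    level 0 receives the maximal cliques as a new level. *)
Definition initv c (R : seq (seq bool)) : mpstate :=
  extendv 1 [seq (0, zerov R) | _ <- R] (cliquesv c R).

Definition mainv d c (R : seq (seq bool)) := runv d.+1 2 d (initv c R).

(** * Polynomial running time of the algorithm *)

Section AlgorithmPtime.
Variable X : encType.
Implicit Types (U V : X -> seq bool) (L : X -> seq (seq bool)) (s : X -> mpstate).

Lemma ptime_subv U V : ptime U -> ptime V -> ptime (fun x => subv (U x) (V x)).
Proof.
move=> pU pV; apply: ptime_all; last exact: (ptime_zip true).
by apply: ptime_imply; ptime_proj.
Qed.

Lemma ptime_disjv U V : ptime U -> ptime V -> ptime (fun x => disjv (U x) (V x)).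
Proof.
move=> pU pV; apply: ptime_all; last exact: (ptime_zip true).
by apply: ptime_neg; apply: ptime_and; ptime_proj.
Qed.

Lemma ptime_orv U V : ptime U -> ptime V -> ptime (fun x => orv (U x) (V x)).
Proof.
move=> pU pV; apply: ptime_map; last exact: (ptime_zip true).
by apply: ptime_or; ptime_proj.
Qed.

Lemma ptime_zerov (Y : encType) (l : X -> seq Y) :
  ptime l -> ptime (fun x => zerov (l x)).
Proof. by move=> pl; apply: ptime_map => //; ptime_proj. Qed.

End AlgorithmPtime.

Lemma size_unitv A (l : seq A) : size (unitv l) = size l.
Proof. by elim: l => //= x l IH; rewrite size_map IH. Qed.

(** [List.In] is used because an [encType] carries no decidable equality. *)
Lemma esize_le_bound (A : encType) (s : seq A) b :
  (forall x, List.In x s -> esize x <= b) -> esize s <= size s * b.+1 + 1.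
Proof.
elim: s => [|x s IH] //= hs; rewrite esize_cons mulSn.
have := hs x (or_introl erefl); have := IH (fun y ys => hs y (or_intror ys)).
move: (_ * _); lia.
Qed.

Lemma esize_bits (s : seq bool) : esize s <= size s * 4 + 1.
Proof. by apply: esize_le_bound => -[]. Qed.

Lemma esize_unitv A (l : seq A) :
  esize (unitv l) <= size l * (size l * 4 + 2) + 1.
Proof.
have row r : List.In r (unitv l) -> esize r <= size l * 4 + 1.
  move=> rl; suff <- : size r = size l by apply: esize_bits.
  elim: l r rl => //= x l IH r [<-|].
    by rewrite /= size_map size_unitv.
  by elim: (unitv l) IH => //= u w IHw IH [<-|]; [rewrite /= IH //; left|
    apply: IHw => v vw; apply: IH; right].
by have := esize_le_bound row; rewrite size_unitv -addnS.
Qed.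

Section AlgorithmPtime2.
Variable X : encType.
Implicit Types (U V : X -> seq bool) (L : X -> seq (seq bool)) (s : X -> mpstate).

Lemma ptime_unitv (Y : encType) (l : X -> seq Y) :
  ptime l -> ptime (fun x => unitv (l x)).
Proof.
move=> pl; have [q ql] := ptime_esize pl.
apply: (@ptime_foldr X Y (seq_encType (seq_encType bool_encType))
  (fun _ _ u => (true :: zerov u) :: [seq false :: r | r <- u]) (fun=> [::]) l
  (fun n => (q.[n])%R * ((q.[n])%R * 4 + 2) + 1)) => //; first by pbound.
- move=> x k; rewrite -/(unitv _); apply: leq_trans (esize_unitv _) _.
  have le : size (drop k (l x)) <= (q.[esize x])%R.
    by apply: leq_trans (ql x); apply: leq_trans (esize_drop k _); apply: ltnW;
       apply: size_esize.
  by rewrite leq_add2r leq_mul // leq_add2r leq_mul2r.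
- apply: ptime_cons.
    by apply: ptime_cons; [ptime_proj|apply: ptime_zerov; ptime_proj].
  by apply: ptime_map; ptime_proj.
- exact: ptime_const.
Qed.

(** The recursion on [d] is unrolled into the program, so program and polynomial both depend on
    [d]. *)
Lemma ptime_unionsv d L U : ptime L -> ptime U ->
  ptime (fun x => unionsv d (L x) (U x)).
Proof.
move=> pL pU; elim: d => [|d IH] /=.
  by apply: ptime_cons => //; exact: ptime_const.
apply: ptime_cat => //; apply: ptime_flatten; apply: ptime_map => //.
apply: ptime_map; first by apply: ptime_orv; ptime_proj.
exact: (ptime_comp (ptime_fst (ptime_id _)) pL).
Qed.

Lemma ptime_maxv L : ptime L -> ptime (fun x => maxv (L x)).
Proof.
move=> pL; apply: ptime_filter => //; apply: ptime_all.
  by apply: ptime_imply; apply: ptime_subv; ptime_proj.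
exact: (ptime_comp (ptime_fst (ptime_id _)) pL).
Qed.

Lemma ptime_dedupv L : ptime L -> ptime (fun x => dedupv (L x)).
Proof.
move=> pL; apply: ptime_foldr_le => //.
- move=> _ l; rewrite -/(dedupv l); elim: l => //= Y l IH; rewrite !esize_cons.
  by case: ifP => _; rewrite ?esize_cons; lia.
- apply: ptime_if; try ptime_proj.
  apply: ptime_has; try ptime_proj.
  by apply: ptime_and; apply: ptime_subv; ptime_proj.
Qed.

Lemma ptime_cnbrs_ge2 i U s : ptime U -> ptime s ->
  ptime (fun x => cnbrs_ge2 i (U x) (s x)).
Proof.
move=> pU ps; apply: ptime_size_ge2; apply: ptime_filter => //.
apply: ptime_and; first by apply: ptime_eqnat; ptime_proj.
apply: ptime_subv; last by ptime_proj.
exact: (ptime_comp (ptime_fst (ptime_id _)) pU).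
Qed.

Lemma ptime_same_nbrsv i U s : ptime U -> ptime s ->
  ptime (fun x => same_nbrsv i (U x) (s x)).
Proof.
move=> pU ps; apply: ptime_all => //.
have pU1 := ptime_comp (ptime_fst (ptime_id (prod_encType X
   (prod_encType nat_encType (seq_encType bool_encType))))) pU.
apply: ptime_imply; first by apply: ptime_eqnat; ptime_proj.
by apply: ptime_or; [apply: ptime_subv|apply: ptime_disjv]; rewrite //; ptime_proj.
Qed.

Lemma ptime_clean_condv p U s : ptime U -> ptime s ->
  ptime (fun x => clean_condv p (s x) (U x)).
Proof.
move=> pU ps; move: p => [|[|[|[|[|p]]]]]; try exact: ptime_const.
all: by repeat first
  [apply: ptime_cnbrs_ge2|apply: ptime_same_nbrsv|apply: ptime_and].
Qed.

Lemma ptime_goodv p U s : ptime U -> ptime s ->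
  ptime (fun x => goodv p (s x) (U x)).
Proof.
move=> pU ps; apply: ptime_and.
  apply: ptime_all; last exact: (ptime_zip (0, [::])).
  by apply: ptime_imply; [ptime_proj|apply: ptime_eqnat; ptime_proj].
apply: ptime_and.
  by apply: ptime_size_ge2; apply: ptime_filter => //; ptime_proj.
apply: ptime_and; last exact: ptime_clean_condv.
apply: ptime_size_ge2; apply: ptime_filter => //.
apply: ptime_subv; last by ptime_proj.
exact: (ptime_comp (ptime_fst (ptime_id _)) pU).
Qed.

Lemma ptime_closev U s : ptime U -> ptime s ->
  ptime (fun x => closev (s x) (U x)).
Proof.
move=> pU ps; apply: ptime_orv => //; apply: ptime_map => //.
apply: ptime_subv; last by ptime_proj.
exact: (ptime_comp (ptime_fst (ptime_id _)) pU).
Qed.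

End AlgorithmPtime2.

Section AlgorithmPtime3.
Variable X : encType.
Implicit Types (U V : X -> seq bool) (L : X -> seq (seq bool)) (s : X -> mpstate).

Lemma ptime_newv p d s : ptime s -> ptime (fun x => newv p d (s x)).
Proof.
move=> ps; apply: ptime_dedupv; apply: ptime_maxv.
have ps1 := ptime_comp (ptime_fst (ptime_id
               (prod_encType X (seq_encType bool_encType)))) ps.
apply: ptime_map; first by apply: ptime_closev => //; ptime_proj.
apply: ptime_filter; first by apply: ptime_goodv => //; ptime_proj.
by apply: ptime_unionsv; [apply: ptime_unitv|apply: ptime_zerov].
Qed.

Lemma ptime_extendv p s L :
  ptime s -> ptime L -> ptime (fun x => extendv p (s x) (L x)).
Proof.
move=> ps pL; apply: ptime_cat.
  apply: ptime_map; last by apply: (ptime_zip (0, [::])) => //; apply: ptime_unitv.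
  apply: ptime_pair; first by ptime_proj.
  apply: ptime_cat; first by ptime_proj.
  apply: ptime_map; last exact: (ptime_comp (ptime_fst (ptime_id _)) pL).
  by apply: ptime_neg; apply: ptime_disjv; ptime_proj.
apply: ptime_map => //; apply: ptime_pair; first exact: ptime_const.
apply: ptime_cat; first by ptime_proj.
by apply: ptime_zerov; exact: (ptime_comp (ptime_fst (ptime_id _)) pL).
Qed.

Lemma ptime_outv p s : ptime s -> ptime (fun x => outv p (s x)).
Proof.
move=> ps; apply: ptime_pair; first exact: ptime_const.
by apply: ptime_pair; apply: ptime_map => //; ptime_proj.
Qed.

(** The number of rounds is a constant, so the rounds are composed one after the other, and a
    bounded number of compositions of polynomials is a polynomial. *)
Lemma ptime_runv fuel p d s : ptime s -> ptime (fun x => runv fuel p d (s x)).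
Proof.
elim: fuel p d s => [|fuel IH] p d s ps /=; first exact: ptime_outv.
apply: ptime_if; last exact: ptime_outv.
  by apply: ptime_is_cons; apply: ptime_newv.
by apply: IH; apply: ptime_extendv => //; apply: ptime_newv.
Qed.

Lemma ptime_cliquesv c L : ptime L -> ptime (fun x => cliquesv c (L x)).
Proof.
move=> pL; apply: ptime_dedupv; apply: ptime_maxv; apply: ptime_filter; last first.
  by apply: ptime_unionsv; [apply: ptime_unitv|apply: ptime_zerov].
have pL1 := ptime_comp (ptime_fst (ptime_id
               (prod_encType X (seq_encType bool_encType)))) pL.
apply: ptime_all.
  apply: ptime_imply; first by ptime_proj.
  by apply: ptime_subv; [ptime_proj|apply: ptime_orv; ptime_proj].
apply: (ptime_zip ([::], [::])); first by ptime_proj.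
by apply: (ptime_zip [::]) => //; apply: ptime_unitv.
Qed.

End AlgorithmPtime3.

Lemma ptime_mainv d c : ptime (mainv d c).
Proof.
rewrite /mainv; apply: ptime_runv; rewrite /initv; apply: ptime_extendv.
  apply: ptime_map; last exact: ptime_id.
  apply: ptime_pair; first exact: ptime_const.
  by apply: ptime_zerov; ptime_proj.
by apply: ptime_cliquesv; apply: ptime_id.
Qed.

(** * Depth and degrees of the clean-factor series *)

Section MultipartiteTheory.
Variable H : mpgraph.
Implicit Types (x y : H) (W : {set H}) (A : {set {set H}}).
Local Notation p := (nparts H).
Local Notation last_part := (part H p.-1).

Lemma in_cnbrs W y : (y \in cnbrs W) = (W \subset nbrs y).
Proof.
apply/bigcapP/subsetP => h x xW; have := h x xW; rewrite !inE; by rewrite adj_sym.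
Qed.

Lemma cnbrs_inE i W : W != set0 -> cnbrs_in i W = cnbrs W :&: part H i.
Proof.
case/set0Pn => x xW; apply/setP => y; rewrite in_setI; apply/bigcapP/andP.
  move=> h; split; last by have := h x xW; rewrite in_setI => /andP[].
  by apply/bigcapP => z /h; rewrite in_setI => /andP[].
by case=> /bigcapP h yi z zW; rewrite in_setI yi h.
Qed.

Lemma cnbrsS W W' : W \subset W' -> cnbrs W' \subset cnbrs W.
Proof.
move=> sW; apply/subsetP => y; rewrite !in_cnbrs; exact: subset_trans.
Qed.

Lemma cnbrsU W W' : cnbrs (W :|: W') = cnbrs W :&: cnbrs W'.
Proof. by apply/setP => y; rewrite in_setI !in_cnbrs subUset. Qed.

Lemma cnbrs1 x : cnbrs [set x] = nbrs x.
Proof. by rewrite /cnbrs big_set1. Qed.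

Lemma same_nbrs_inP i W :
  reflect {in W &, forall x y, nbrs_in i x = nbrs_in i y} (same_nbrs_in i W).
Proof.
apply: (iffP forall_inP) => h x.
  by move=> y xW yW; apply/eqP; have /forall_inP := h x xW; apply.
by move=> xW; apply/forall_inP => y yW; apply/eqP; apply: h.
Qed.

Lemma same_nbrs_inS i W W' :
  W \subset W' -> same_nbrs_in i W' -> same_nbrs_in i W.
Proof.
by move=> /subsetP sW /same_nbrs_inP h; apply/same_nbrs_inP => x y /sW xW /sW;
   apply: h.
Qed.

Lemma same_nbrs_in_cnbrs i W x :
  same_nbrs_in i W -> x \in W -> cnbrs W :&: part H i = nbrs_in i x.
Proof.
move=> /same_nbrs_inP h xW; apply/setP => y; rewrite !in_setI in_cnbrs.
apply/andP/andP => -[h1 h2]; split=> //.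
  by have := subsetP h1 x xW; rewrite !inE adj_sym.
apply/subsetP => z zW.
have : y \in nbrs_in i x by rewrite in_setI h1.
by rewrite (h x z xW zW) in_setI !inE adj_sym => /andP[].
Qed.

Lemma same_nbrs_inU i W W' :
  same_nbrs_in i W -> same_nbrs_in i W' -> W :&: W' != set0 ->
  same_nbrs_in i (W :|: W').
Proof.
move=> /same_nbrs_inP h /same_nbrs_inP h' /set0Pn[z /setIP[zW zW']].
have hz x : x \in W :|: W' -> nbrs_in i x = nbrs_in i z.
  by case/setUP => xW; [apply: h|apply: h'].
by apply/same_nbrs_inP => x y xW yW; rewrite !hz.
Qed.

(** Shrinking a set enlarges its common neighbourhoods and preserves equality of neighbourhoods.
    This reduces questions about admissible sets to pairs of their elements. *)
Lemma clean_condS W W' :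
  W != set0 -> W \subset W' -> clean_cond W' -> clean_cond W.
Proof.
move=> W0 sW; have W'0 : W' != set0 by apply: subset_neq0 sW W0.
have le i : 2 <= #|cnbrs_in i W'| -> 2 <= #|cnbrs_in i W|.
  move/leq_trans; apply; apply: subset_leq_card.
  by rewrite !cnbrs_inE // setSI // cnbrsS.
have same i := @same_nbrs_inS i _ _ sW.
rewrite /clean_cond; case: (nparts H) => [|[|[|[|[|m]]]]] //.
- by case/andP => /le-> /le->.
- by case/and3P => /le-> /le-> /same->.
- by case/and3P => /le-> /same-> /le->.
Qed.

(** Equal common neighbourhoods keep the counting conditions intact, and a shared element transfers
    the equality of neighbourhoods from one set to the other. *)
Lemma clean_condU W W' : clean_cond W -> clean_cond W' ->
  cnbrs W = cnbrs W' -> W :&: W' != set0 -> clean_cond (W :|: W').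
Proof.
move=> + + eqW WW'.
have W0 : W != set0 by apply: subset_neq0 WW'; apply: subsetIl.
have U0 : W :|: W' != set0 by apply: subset_neq0 W0; apply: subsetUl.
have cE i : cnbrs_in i (W :|: W') = cnbrs_in i W.
  by rewrite !cnbrs_inE // cnbrsU -eqW setIid.
have same i h h' := @same_nbrs_inU i W W' h h' WW'.
rewrite /clean_cond; case: (nparts H) => [|[|[|[|[|m]]]]] //; rewrite !cE //.
- by case/and3P => -> -> h /and3P[_ _ h']; rewrite same.
- by case/and3P => -> h -> /and3P[_ h' _]; rewrite same.
Qed.

(** The common core of the cases [p = 4] and [p >= 5]: only the level of constant neighbourhoods
    differs, being 0 instead of [p - 3 = 1] when [p = 4]. *)
Lemma clean_cond_ge4 W : 4 <= p -> clean_cond W ->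
  2 <= #|cnbrs_in (p - 2) W| /\
  same_nbrs_in (if p == 4 then 0 else p - 3) W.
Proof.
rewrite /clean_cond; case: (nparts H) => [|[|[|[|[|m]]]]] // _; by case/and3P.
Qed.

Lemma maximal_setsP A X :
  reflect (X \in A /\ forall Y, Y \in A -> X \subset Y -> Y = X)
          (X \in maximal_sets A).
Proof.
rewrite inE; apply: (iffP andP) => -[XA h]; split=> //.
  by move=> Y YA XY; apply/eqP; move/forall_inP: h => /(_ Y YA)/implyP; apply.
by apply/forall_inP => Y YA; apply/implyP => XY; rewrite (h Y YA XY).
Qed.

Lemma cnbrs_last W : W \subset last_part -> W != set0 ->
  cnbrs W :&: last_part = set0.
Proof.
move=> WP /set0Pn[x xW]; apply/setP => y; rewrite in_setI in_set0.
apply/negP => /andP[/bigcapP/(_ x xW)]; rewrite !inE => /adj_lev.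
have := subsetP WP x xW; rewrite inE => /eqP lx.
by rewrite -(inj_eq val_inj) /= lx eq_sym => /negbTE->.
Qed.

(** No edge runs inside a level, so the generating set can be read off from the set that it
    generates. *)
Lemma close_last W : W \subset last_part -> W != set0 ->
  (W :|: cnbrs W) :&: last_part = W.
Proof.
by move=> WP W0; rewrite setIUl cnbrs_last // setU0; apply/setIidPl.
Qed.

Lemma close_part i W : W \subset last_part -> i != p.-1 ->
  (W :|: cnbrs W) :&: part H i = cnbrs W :&: part H i.
Proof.
move=> WP ip; rewrite setIUl; have -> : W :&: part H i = set0; last by rewrite set0U.
apply/setP => y; rewrite in_setI in_set0; apply/negP => /andP[/(subsetP WP)].
by rewrite !inE => /eqP->; rewrite eq_sym (negbTE ip).
Qed.

Lemma star_setsP X :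
  reflect (exists W, [/\ W \subset last_part, 2 <= #|W|, 2 <= #|cnbrs W|,
                         clean_cond W & X = W :|: cnbrs W])
          (X \in star_sets H).
Proof.
have ne0 W : 2 <= #|W| -> W != set0 by move=> h; rewrite -card_gt0 ltnW.
rewrite inE; apply: (iffP andP) => [[/imsetP[W]]|[W [WP W2 cW2 cW ->]]].
  rewrite inE powersetE => /and3P[WP W2 cW2] -> {X}.
  by rewrite close_last ?ne0 // => cW; exists W.
rewrite close_last ?ne0 //; split=> //; apply/imsetP; exists W => //.
by rewrite inE powersetE WP W2.
Qed.

End MultipartiteTheory.

(** * Depth and degrees under one clean factorisation *)

Section CleanFactorTheory.
Variable H : mpgraph.
Local Notation p := (nparts H).
Local Notation H' := (clean_factor H).
Local Notation new_vertex := {X | X \in maximal_sets (star_sets H)}.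
Implicit Types (X : new_vertex).

Lemma new_vertexP X : exists W : {set H},
  [/\ W \subset part H p.-1, 2 <= #|W|, 2 <= #|cnbrs W|, clean_cond W
    & val X = W :|: cnbrs W].
Proof. by have /maximal_setsP[/star_setsP] := valP X. Qed.

Lemma nbrs_new X : nbrs (inr X : H') = inl @: val X.
Proof.
apply/setP => -[y|Y]; rewrite inE /=.
  by rewrite (mem_imset _ _ (@inl_inj _ _)).
by apply/esym/negP => /imsetP[].
Qed.

Lemma part_inl i (x : H) : (inl x \in part H' i) = (x \in part H i).
Proof. by rewrite !inE. Qed.

Lemma nbrs_in_new i X : nbrs_in i (inr X : H') = inl @: (val X :&: part H i).
Proof.
rewrite /nbrs_in nbrs_new; apply/setP => -[y|Y]; last first.
  by rewrite inE; apply/andP/imsetP => [[/imsetP[]]|[]].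
rewrite in_setI part_inl !(mem_imset _ _ (@inl_inj _ _)); by rewrite in_setI.
Qed.

Lemma nbrs_in_new_inj i X X' :
  nbrs_in i (inr X : H') = nbrs_in i (inr X' : H') ->
  val X :&: part H i = val X' :&: part H i.
Proof. by rewrite !nbrs_in_new => /(imset_inj (@inl_inj _ _)). Qed.

Lemma in_last_part (u : H') : u \in part H' p -> exists X, u = inr X.
Proof.
by case: u => [x|X]; [rewrite part_inl inE ltn_eqF|exists X].
Qed.

Local Notation new X := (inr X : H').

(** The new graph has at least four levels. Its clean condition gives the pair a common neighbour in
    level [p.-1], which lies in both generating sets, and equal neighbourhoods in level [p - 2], or
    0 if [p = 3]. *)
Lemma new_pair_common X X' (W W' : {set H}) : 2 < p ->
    W \subset part H p.-1 -> W != set0 -> val X = W :|: cnbrs W ->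
    W' \subset part H p.-1 -> W' != set0 -> val X' = W' :|: cnbrs W' ->
    clean_cond [set new X; new X'] ->
  W :&: W' != set0 /\
  (let i := if p == 3 then 0 else p - 2 in
   nbrs_in i (new X) = nbrs_in i (new X')).
Proof.
move=> p3 WP W0 XE W'P W'0 X'E cXX'.
have [|c2 /same_nbrs_inP same] := clean_cond_ge4 _ cXX'; first by [].
have ne : [set new X; new X'] != set0.
  by apply/set0Pn; exists (new X); rewrite !inE eqxx.
split; last first.
  have := same (new X) (new X'); rewrite !inE !eqxx orbT /= eqSS subSS.
  exact.
move: c2; rewrite cnbrs_inE // => /ltnW/card_gt0P[u].
rewrite in_setI in_cnbrs subUset !sub1set /= => /andP[/andP[uX uX'] up].
have mem Y : new Y \in nbrs u -> u \in nbrs_in p.-1 (new Y).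
  by rewrite in_setI !inE adj_sym => ->; move: up; rewrite inE -subn1 subSS.
have := mem _ uX; rewrite nbrs_in_new XE close_last // => /imsetP[y yW uy].
have := mem _ uX'; rewrite nbrs_in_new X'E close_last // => /imsetP[y' yW'].
rewrite uy => -[yy']; apply/set0Pn; exists y.
by rewrite in_setI yW yy' yW'.
Qed.

(* |N_1| decreases by at least 1 from one level to the next, because two
   elements of a set of the factorisation are separated by N_1. *)
Definition depth_bounded K (G : mpgraph) : Prop :=
  2 < nparts G ->
  [/\ {in part G (nparts G).-1 &, forall x x', clean_cond [set x; x'] ->
         nbrs_in 1 x = nbrs_in 1 x' -> x = x'},
      3 < nparts G ->
      {in part G (nparts G).-1 &, forall x x', clean_cond [set x; x'] ->
         forall i, i + 3 <= nparts G -> i != 1 -> nbrs_in i x = nbrs_in i x'}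
    & {in part G (nparts G).-1, forall x, #|nbrs_in 1 x| + nparts G <= K + 3}].

(** The three clauses are carried together: agreement on the low levels other than 1 makes [N_1]
    separate the new vertices, and separation by [N_1] in the old graph makes [N_1] shrink in the
    new one. *)
Lemma depth_bounded_step K : 1 < p -> (p = 2 -> forall x : H, #|nbrs x| <= K) ->
  depth_bounded K H -> depth_bounded K H'.
Proof.
move=> p2 degH dH _; rewrite [nparts H']/=.
have ne0 (W : {set H}) : 2 <= #|W| -> W != set0.
  by move=> h; rewrite -card_gt0 ltnW.
have close_low (X : new_vertex) (W : {set H}) i : W \subset part H p.-1 ->
    val X = W :|: cnbrs W -> i < p.-1 -> val X :&: part H i = cnbrs W :&: part H i.
  by move=> WP -> ip; rewrite close_part // neq_ltn ip.
(* Agreement on every level up to [p - 2] except 1. The topmost of these comes from the clean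
   condition of the pair. On each lower one, both sets inherit the neighbourhood of a common member
   [t] of [W] and [W'], by the second clause for the old graph. *)
have low X X' (W W' : {set H}) : 2 < p ->
    W \subset part H p.-1 -> 2 <= #|W| -> clean_cond W -> val X = W :|: cnbrs W ->
    W' \subset part H p.-1 -> 2 <= #|W'| -> clean_cond W' ->
    val X' = W' :|: cnbrs W' ->
    clean_cond [set new X; new X'] ->
    forall i, i + 2 <= p -> i != 1 -> nbrs_in i (new X) = nbrs_in i (new X').
  move=> p3 WP W2 cW XE W'P W'2 cW' X'E cXX' i ip i1.
  have [/set0Pn[t /setIP[tW tW']] top] :=
    new_pair_common p3 WP (ne0 _ W2) XE W'P (ne0 _ W'2) X'E cXX'.
  have [p4|p4] := ltnP 3 p; last first.
    move: top; have -> : p == 3 by rewrite eqn_leq p4.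
    by have -> : i = 0 by lia.
  have [ip'|ip'] := leqP (i + 3) p; last first.
    have p3F : p == 3 = false by lia.
    by move: top; rewrite p3F; have -> : i = p - 2 by lia.
  have [_ /(_ p4) same _] := dH p3.
  have nE (Y : new_vertex) (V : {set H}) :
      V \subset part H p.-1 -> clean_cond V -> t \in V ->
      val Y = V :|: cnbrs V -> nbrs_in i (new Y) = inl @: nbrs_in i t.
    move=> VP cV tV YE; rewrite nbrs_in_new (close_low Y V) //; last by lia.
    rewrite (@same_nbrs_in_cnbrs _ i V t) //; apply/same_nbrs_inP => x y xV yV.
    apply: same; rewrite ?(subsetP VP) //; apply: clean_condS cV.
      by apply/set0Pn; exists x; rewrite !inE eqxx.
    by rewrite subUset !sub1set xV.
  by rewrite (nE X W) // (nE X' W').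
split.
- move=> u u' /in_last_part[X ->{u}] /in_last_part[X' ->{u'}] cXX' N1.
  have [W [WP W2 cW2 cW XE]] := new_vertexP X.
  have [W' [W'P W'2 cW'2 cW' X'E]] := new_vertexP X'.
  suff WW' : W = W' by congr inr; apply: val_inj; rewrite XE X'E WW'.
  (* With two old levels, level 1 is the last one, and [N_1] of a new vertex is its whole generating
     set. *)
  have [p3|p3] := ltnP 2 p; last first.
    have pE : p.-1 = 1 by lia.
    have := nbrs_in_new_inj N1; rewrite XE X'E -pE.
    by rewrite !close_last // ne0.
  have [WW' _] := new_pair_common p3 WP (ne0 _ W2) XE W'P (ne0 _ W'2) X'E cXX'.
  (* Level 1 agrees by assumption, the other levels below [p.-1] by [low], and level [p.-1] contains
     no common neighbours of its own vertices. *)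
  have cE : cnbrs W = cnbrs W'.
    have same i : i < p.-1 -> cnbrs W :&: part H i = cnbrs W' :&: part H i.
      move=> ip; rewrite -(close_low X) // -(close_low X') //.
      apply: nbrs_in_new_inj; case: (eqVneq i 1) => [-> //|i1].
      by apply: (low X X' W W') => //; lia.
    have sub (V V' : {set H}) : V \subset part H p.-1 -> V != set0 ->
        (forall i, i < p.-1 -> cnbrs V :&: part H i = cnbrs V' :&: part H i) ->
        cnbrs V \subset cnbrs V'.
      move=> VP V0 VV'; apply/subsetP => y yV.
      have : y \in cnbrs V :&: part H (lev y) by rewrite in_setI yV inE eqxx.
      rewrite VV' ?in_setI => [/andP[]//|]; rewrite ltn_neqAle.
      have -> : lev y <= p.-1 by have := ltn_ord (lev y); lia.
      rewrite andbT; apply/eqP => yp.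
      have : y \in cnbrs V :&: part H p.-1 by rewrite in_setI yV inE yp eqxx.
      by rewrite cnbrs_last // inE.
    apply/eqP; rewrite eqEsubset !sub ?ne0 // => i ip; by rewrite same.
  (* The union of the generating sets is again admissible, with the same common neighbourhood, so
     maximality of both sets makes each generating set equal to the union. *)
  have US : W :|: W' :|: cnbrs (W :|: W') \in star_sets H.
    apply/star_setsP; exists (W :|: W'); split=> //.
    + by rewrite subUset WP.
    + by apply: leq_trans W2 _; rewrite subset_leq_card // subsetUl.
    + by rewrite cnbrsU -cE setIid.
    + exact: clean_condU.
  have maxE (V : {set H}) (Y : new_vertex) :
      V \subset W :|: W' -> V \subset part H p.-1 ->
      2 <= #|V| -> cnbrs V = cnbrs W -> val Y = V :|: cnbrs V -> V = W :|: W'.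
    move=> VU VP V2 cV YE; have /maximal_setsP[_ mY] := valP Y.
    have UE := mY _ US; rewrite -(@close_last _ V) ?ne0 // -YE -UE ?close_last //.
    + by rewrite subUset WP.
    + by apply: subset_neq0 (ne0 _ W2); apply: subsetUl.
    + by rewrite YE cnbrsU -cE setIid cV setSU.
  transitivity (W :|: W'); first by apply: (maxE W X); rewrite ?subsetUl.
  by apply/esym/(maxE W' X'); rewrite ?subsetUr.
- move=> p3 u u' /in_last_part[X ->{u}] /in_last_part[X' ->{u'}] cXX' i ip i1.
  have [W [WP W2 cW2 cW XE]] := new_vertexP X.
  have [W' [W'P W'2 cW'2 cW' X'E]] := new_vertexP X'.
  by apply: (low X X' W W') => //; lia.
- move=> u /in_last_part[X ->{u}].
  have [W [WP W2 cW2 cW XE]] := new_vertexP X.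
  rewrite nbrs_in_new card_imset; last exact: inl_inj.
  (* The starting value of the descent: with two old levels, [N_1] is [W], which lies in the
     neighbourhood of any common neighbour [y] and so has at most [K] elements. *)
  have [p3|p3] := ltnP 2 p; last first.
    have pE : p.-1 = 1 by lia.
    rewrite XE -pE close_last ?ne0 //.
    have /card_gt0P[y] : 0 < #|cnbrs W| by rewrite ltnW.
    have p2E : p = 2 by lia.
    by rewrite in_cnbrs => /subset_leq_card; have := degH p2E y; lia.
  (* [N_1] of the new vertex is contained in [N_1] of [x] and of [x']. These differ by the first
     clause, so at least one of the inclusions is strict. *)
  have /card_gt1P[x [x' [xW x'W xx']]] := W2.
  have [sep _ N1] := dH p3.
  have sW : [set x; x'] \subset W by rewrite subUset !sub1set xW.
  have cxx' : clean_cond [set x; x'].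
    by apply: clean_condS cW => //; apply/set0Pn; exists x; rewrite !inE eqxx.
  have xP := subsetP WP x xW; have x'P := subsetP WP x' x'W.
  have sub y : y \in W -> val X :&: part H 1 \subset nbrs_in 1 y.
    move=> yW; rewrite (close_low X W) //; last by lia.
    rewrite setSI // -cnbrs1 cnbrsS // sub1set //.
  have [eqx|nex] := eqVneq (val X :&: part H 1) (nbrs_in 1 x).
    have : val X :&: part H 1 \proper nbrs_in 1 x'.
      rewrite properEneq sub // andbT eqx; apply: contraNneq xx' => ?.
      by apply/eqP/sep.
    by move/proper_card; have := N1 x' x'P; lia.
  have : val X :&: part H 1 \proper nbrs_in 1 x by rewrite properEneq nex sub.
  by move/proper_card; have := N1 x xP; lia.
Qed.

Lemma degree_bounded_step D : (forall x : H, #|nbrs x| <= D) ->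
  forall u : H', #|nbrs u| <= next_degree D.
Proof.
move=> degH.
have ne0 (W : {set H}) : 2 <= #|W| -> exists x, x \in W.
  by move=> h; apply/card_gt0P; apply: ltnW.
case=> [x|X]; last first.
  rewrite nbrs_new card_imset; last exact: inl_inj.
  have [W [WP W2 cW2 cW ->]] := new_vertexP X.
  have [[x xW] [y yW]] := (ne0 _ W2, ne0 _ cW2).
  apply: leq_trans (leq_card_setU _ _) _; apply: leq_trans (leq_addr _ _).
  apply: leq_add; first by apply: leq_trans (degH y); rewrite subset_leq_card -?in_cnbrs.
  by apply: leq_trans (degH x); rewrite subset_leq_card // -cnbrs1 cnbrsS ?sub1set.
(* If [x] is a common neighbour of the generating set, that set lies in [nbrs x]. If [x] belongs to
   it, the set lies in the neighbourhood of a common neighbour, itself adjacent to [x]. *)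
pose near := nbrs x :|: \bigcup_(y in nbrs x) nbrs y.
have card_near : #|near| <= D + D * D.
  apply: leq_trans (leq_card_setU _ _) _; apply: leq_add => //.
  apply: (@leq_trans (\sum_(y in nbrs x) #|nbrs y|)).
    elim/big_rec2: _ => [|y m B _ IH]; first by rewrite cards0.
    by apply: leq_trans (leq_card_setU _ _) _; rewrite leq_add2l.
  apply: (@leq_trans (\sum_(y in nbrs x) D)); first by apply: leq_sum => y _.
  by rewrite sum_nat_const leq_mul2r degH orbT.
pose old : {set H'} := inl @: nbrs x.
pose up : {set H'} := inr @: [set X : new_vertex | x \in val X].
have /subset_leq_card/leq_trans : nbrs (inl x : H') \subset old :|: up.
  apply/subsetP => -[y|Y]; rewrite inE /= => xy; apply/setUP.
    by left; apply: imset_f; rewrite inE.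
  by right; apply: imset_f; rewrite inE.
apply; apply: leq_trans (leq_card_setU _ _) _.
rewrite !card_imset; try by [exact: inl_inj|exact: inr_inj].
rewrite /next_degree -addnA leq_add // (leq_trans _ (leq_addl _ _)) //.
pose low (X : new_vertex) := val X :&: part H p.-1.
have low_inj : injective low.
  move=> X X'; rewrite /low.
  have [W [WP W2 cW2 cW XE]] := new_vertexP X.
  have [W' [W'P W'2 cW'2 cW' X'E]] := new_vertexP X'.
  have W0 : W != set0 by rewrite -card_gt0 ltnW.
  have W'0 : W' != set0 by rewrite -card_gt0 ltnW.
  by rewrite XE X'E !close_last // => WW'; apply: val_inj; rewrite XE X'E WW'.
rewrite -(card_imset _ low_inj); apply: (@leq_trans #|powerset near|); last first.
  by rewrite card_powerset leq_exp2l.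
apply: subset_leq_card; apply/subsetP => _ /imsetP[X + ->].
rewrite inE powersetE /low.
have [W [WP W2 cW2 cW XE]] := new_vertexP X.
have W0 : W != set0 by rewrite -card_gt0 ltnW.
rewrite XE close_last // => /setUP[xW|xW]; last first.
  by apply: subset_trans (subsetUl _ _); rewrite -in_cnbrs.
have [y yW] := ne0 _ cW2; apply: subset_trans (subsetUr _ _).
have yx : y \in nbrs x.
  by move: yW; rewrite in_cnbrs => /subsetP/(_ x xW); rewrite !inE adj_sym.
by apply: (bigcup_max y) => //; rewrite -in_cnbrs.
Qed.

End CleanFactorTheory.

(** * Correctness of the algorithm *)

Definition bits (T : finType) (s : seq T) (A : {set T}) : seq bool :=
  [seq v \in A | v <- s].

Definition enumerates (T : finType) (s : seq T) := uniq s /\ (forall v, v \in s).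

Section BitVectors.
Variables (T : finType) (s : seq T).
Hypothesis s_enum : enumerates s.
Implicit Types (A B : {set T}) (L : seq {set T}).
Local Notation bs := (bits s).

Lemma zip_map2 (U V : Type) (f : T -> U) (g : T -> V) (l : seq T) :
  zip [seq f v | v <- l] [seq g v | v <- l] = [seq (f v, g v) | v <- l].
Proof. by elim: l => //= v l ->. Qed.

Lemma subvE A B : subv (bs A) (bs B) = (A \subset B).
Proof.
rewrite /subv zip_map2 all_map; apply/allP/subsetP => [h v vA|h v _ /=].
  by have /implyP := h v (s_enum.2 v); apply.
exact/implyP/h.
Qed.

Lemma disjvE A B : disjv (bs A) (bs B) = [disjoint A & B].
Proof.
rewrite /disjv zip_map2 all_map disjoint_subset.
apply/allP/subsetP => [h v vA|h v _ /=].
  by have := h v (s_enum.2 v); rewrite /= vA.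
by apply/negP => /andP[/h]; rewrite inE => /negbTE->.
Qed.

Lemma orvE A B : orv (bs A) (bs B) = bs (A :|: B).
Proof.
by rewrite /orv zip_map2 -map_comp; apply: eq_map => v; rewrite /= in_setU.
Qed.

Lemma zerovE (U : Type) (f : T -> U) : zerov [seq f v | v <- s] = bs set0.
Proof. by rewrite /zerov -map_comp; apply: eq_map => v; rewrite /= in_set0. Qed.

(** Here the absence of repetitions in [s] matters: a vertex listed twice would give its singleton
    two true bits. *)
Lemma unitvE (U : Type) (f : T -> U) :
  unitv [seq f v | v <- s] = [seq bs [set v] | v <- s].
Proof.
rewrite /bits; elim: (s) s_enum.1 => //= v l IH /andP[vl /IH->].
rewrite set11; congr cons; first congr cons.
  rewrite /zerov -map_comp; apply/eq_in_map => u ul /=.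
  by rewrite inE; apply/esym/negbTE; apply: contraNneq vl => <-.
rewrite -map_comp; apply/eq_in_map => u ul /=; congr cons.
by rewrite inE; apply/esym/negbTE; apply: contraNneq vl => ->.
Qed.

Fixpoint small_sets d : seq {set T} :=
  if d is d'.+1 then
    flatten [seq [seq A :|: [set v] | v <- s] | A <- small_sets d'] ++ small_sets d'
  else [:: set0].

Lemma unionsvE d :
  unionsv d [seq bs [set v] | v <- s] (bs set0) = map bs (small_sets d).
Proof.
elim: d => //= d ->; rewrite map_cat map_flatten -!map_comp; congr (flatten _ ++ _).
by apply: eq_map => A; rewrite /= -!map_comp; apply: eq_map => v; rewrite /= orvE.
Qed.

Lemma mem_small_sets d A : #|A| <= d -> A \in small_sets d.
Proof.
elim: d A => [|d IH] A /=; first by rewrite leqn0 cards_eq0 inE.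
rewrite mem_cat; case: (set_0Vmem A) => [-> _|[v vA]].
  by rewrite IH ?cards0 // orbT.
rewrite (cardsD1 v) vA => Ad; apply/orP; left; apply/flatten_mapP.
exists (A :\ v); first exact: IH.
by apply/mapP; exists v; rewrite ?s_enum.2 // setUC setD1K.
Qed.

Lemma size_filter_card (P : pred T) : size [seq v <- s | P v] = #|[set v | P v]|.
Proof.
rewrite cardE; apply: perm_size; apply: uniq_perm.
- by rewrite filter_uniq // s_enum.1.
- exact: enum_uniq.
- by move=> v; rewrite mem_filter s_enum.2 andbT mem_enum inE.
Qed.

(** The order of [NL] is left open, since [represents] admits any order of the new vertices. *)
Lemma dedupv_maxvE L : exists NL : seq {set T}, [/\ uniq NL,
   dedupv (maxv (map bs L)) = map bs NL
 & forall X : {set T}, (X \in NL) =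
     (X \in L) && all (fun Y : {set T} => (X \subset Y) ==> (Y \subset X)) L].
Proof.
exists (undup [seq X : {set T} <- L |
  all (fun Y : {set T} => (X \subset Y) ==> (Y \subset X)) L]).
split; first exact: undup_uniq.
  have -> : maxv (map bs L) =
      map bs [seq X : {set T} <- L |
        all (fun Y : {set T} => (X \subset Y) ==> (Y \subset X)) L].
    rewrite /maxv filter_map; congr map; apply: eq_filter => X /=.
    by rewrite all_map; apply: eq_all => Y; rewrite /= !subvE.
  elim: [seq X <- L | _] => //= X l; rewrite -/(dedupv _) => ->.
  have -> : has (fun Y => subv (bs X) Y && subv Y (bs X)) (map bs (undup l))
          = (X \in l).
    rewrite has_map -mem_undup; apply/hasP/idP => [[Y Yl /=]|Xl].
      by rewrite !subvE -eqEsubset => /eqP->.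
    by exists X; rewrite //= !subvE subxx.
  by case: ifP.
by move=> X; rewrite mem_undup mem_filter andbC.
Qed.

End BitVectors.

(** New vertices are elements of a subtype, whereas the algorithm lists the underlying sets; this
    passes from one to the other. *)
Lemma lift_seq (T : finType) (A : {set T}) (l : seq T) :
  uniq l -> l =i A ->
  exists2 l' : seq {x | x \in A}, map val l' = l & enumerates l'.
Proof.
move=> ul lA.
have [l' l'E] : exists l' : seq {x | x \in A}, map val l' = l.
  have {ul lA} : all (mem A) l by apply/allP => x; rewrite lA.
  elim: l => [_|x l IH /= /andP[xA /IH[l' <-]]]; first by exists [::].
  by exists (exist _ x xA :: l').
exists l' => //; split; first by rewrite -(map_inj_uniq val_inj) l'E.
by move=> x; rewrite -(mem_map val_inj) l'E lA; apply: valP.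
Qed.

Definition state (H : mpgraph) (s : seq H) : mpstate :=
  [seq (lev v : nat, bits s (nbrs v)) | v <- s].

(** Levels and rows are arbitrary, so that the statement covers both the edgeless initial state and
    the states of a factorisation. *)
Lemma extendvE (T : finType) (s : seq T) p (l : T -> nat) (R : T -> {set T})
    (NL : seq {set T}) : enumerates s ->
  extendv p [seq (l v, bits s (R v)) | v <- s] (map (bits s) NL) =
  [seq (l v, bits s (R v) ++ [seq v \in X | X : {set T} <- NL]) | v <- s] ++
  [seq (p, bits s X ++ [seq false | _ <- NL]) | X : {set T} <- NL].
Proof.
move=> se; rewrite /extendv unitvE // zip_map2 -!map_comp; congr (_ ++ _).
  apply: eq_map => v /=; rewrite -map_comp; congr (_, _ ++ _).
  by apply: eq_map => X; rewrite /= disjvE // disjoints1 negbK.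
by apply: eq_map => X; rewrite /= /zerov -map_comp.
Qed.

(** * One round of the algorithm against one factorisation *)

Section StateCorrectness.
Variables (H : mpgraph) (s : seq H).
Hypothesis s_enum : enumerates s.
Implicit Types (W : {set H}).
Local Notation p := (nparts H).

Lemma cnbrs_ge2E i W : W != set0 ->
  cnbrs_ge2 i (bits s W) (state s) = (2 <= #|cnbrs_in i W|).
Proof.
move=> W0; rewrite /cnbrs_ge2 /state filter_map size_map size_filter_card //.
congr (_ < _); apply: eq_card => v.
by rewrite cnbrs_inE // !inE /= subvE // in_cnbrs andbC.
Qed.

Lemma same_nbrsvE i W :
  same_nbrsv i (bits s W) (state s) = same_nbrs_in i W.
Proof.
rewrite /same_nbrsv /state all_map; apply/allP/same_nbrs_inP => [h x y xW yW|h v _ /=].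
  apply/setP => v; rewrite !in_setI; have := h v (s_enum.2 v).
  rewrite /= subvE // disjvE // ![_ \in part _ _]inE.
  case: eqP => _ /=; last by rewrite !andbF.
  rewrite !andbT => /orP[/subsetP sW|].
    by have := (sW x xW, sW y yW); rewrite !inE ![adj v _]adj_sym => -[-> ->].
  rewrite disjoint_subset => /subsetP sW.
  by have := (sW x xW, sW y yW); rewrite !inE ![adj v _]adj_sym
    => -[/negbTE-> /negbTE->].
apply/implyP => vi; rewrite subvE // disjvE // -implyNb.
apply/implyP => /subsetPn[x xW xv]; rewrite disjoint_subset.
apply/subsetP => y yW; rewrite !inE; have := h x y xW yW.
move/setP/(_ v); rewrite !in_setI !inE vi !andbT ![adj _ v]adj_sym => <-.
by move: xv; rewrite inE.
Qed.

Lemma clean_condvE W : W != set0 ->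
  clean_condv p (state s) (bits s W) = clean_cond W.
Proof.
move=> W0; rewrite /clean_condv /clean_cond.
by case: (nparts H) => [|[|[|[|[|m]]]]] //; rewrite !cnbrs_ge2E // !same_nbrsvE.
Qed.

Lemma goodvE W : goodv p (state s) (bits s W) =
  [&& W \subset part H p.-1, 2 <= #|W|, 2 <= #|cnbrs W| & clean_cond W].
Proof.
have -> : goodv p (state s) (bits s W) =
   [&& W \subset part H p.-1, 2 <= #|W|, 2 <= #|cnbrs W|
     & clean_condv p (state s) (bits s W)].
  congr [&& _, _, _ & _].
  - rewrite /in_levelv zip_map2 all_map; apply/allP/subsetP => [h v vW|h v _ /=].
      by have /implyP/(_ vW) := h v (s_enum.2 v); rewrite inE.
    by apply/implyP => /h; rewrite inE.
  - rewrite filter_map size_map size_filter_card //; congr (_ < _).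
    by apply: eq_card => v; rewrite inE.
  - rewrite filter_map size_map size_filter_card //; congr (_ < _).
    by apply: eq_card => v; rewrite inE /= subvE // in_cnbrs.
by case: ltnP => //= W2; rewrite clean_condvE // -card_gt0 ltnW.
Qed.

Lemma closevE W : closev (state s) (bits s W) = bits s (W :|: cnbrs W).
Proof.
rewrite /closev -orvE; congr orv; rewrite -map_comp.
by apply: eq_map => v; rewrite /= subvE // in_cnbrs.
Qed.

(** A generating set lies in the neighbourhood of any of its common neighbours, so it has at most
    [d] elements and the enumeration of small sets does not miss it. *)
Lemma newvE d : (forall x : H, #|nbrs x| <= d) ->
  exists NL, [/\ uniq NL, NL =i maximal_sets (star_sets H)
               & newv p d (state s) = map (bits s) NL].
Proof.
move=> degH.
pose L := [seq W :|: cnbrs W | W <- small_sets s d &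
  [&& W \subset part H p.-1, 2 <= #|W|, 2 <= #|cnbrs W| & clean_cond W]].
have LE : L =i star_sets H.
  move=> X; apply/mapP/star_setsP => [[W]|[W [WP W2 cW2 cW ->]]].
    by rewrite mem_filter => /andP[/and4P[WP W2 cW2 cW] _] ->; exists W.
  exists W; rewrite // mem_filter WP W2 cW2 cW mem_small_sets //.
  have /card_gt0P[y] : 0 < #|cnbrs W| by apply: ltnW.
  by rewrite in_cnbrs => /subset_leq_card/leq_trans; apply.
have [NL [uNL NLE memNL]] := dedupv_maxvE s_enum L.
exists NL; split => //.
  move=> X; rewrite memNL LE; apply/andP/maximal_setsP => -[XL h]; split=> //.
    move=> Y YL XY; apply/eqP; rewrite eqEsubset XY andbT.
    by move/allP: h => /(_ Y); rewrite LE YL XY; apply.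
  by apply/allP => Y; rewrite LE => YL; apply/implyP => /(h Y YL)->.
rewrite -NLE; congr (dedupv (maxv _)).
rewrite unitvE // zerovE unionsvE filter_map -!map_comp.
rewrite (eq_filter (a2 := fun W => goodv p (state s) (bits s W))) //.
rewrite (eq_filter goodvE); apply: eq_map => W; exact: closevE.
Qed.

Lemma clean_factor_state NL : uniq NL -> NL =i maximal_sets (star_sets H) ->
  exists s' : seq (clean_factor H), [/\ enumerates s', prefix (map inl s) s'
    & extendv p (state s) (map (bits s) NL) = state s'].
Proof.
move=> uNL NLE; have [NS NSE [uNS NSall]] := lift_seq uNL NLE.
exists (map inl s ++ map inr NS); split; last 2 first.
- by rewrite prefix_prefix.
- rewrite /state extendvE // map_cat -!map_comp; congr (_ ++ _).
    apply: eq_map => v /=; congr pair; rewrite /bits map_cat -!map_comp.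
    congr (_ ++ _); first by apply: eq_map => u /=; rewrite !inE.
    by rewrite -NSE -map_comp; apply: eq_map => X /=; rewrite !inE.
  rewrite -{2}NSE -map_comp; apply: eq_map => X /=; congr pair.
  rewrite /bits map_cat -!map_comp; congr (_ ++ _).
    by apply: eq_map => u /=; rewrite !inE.
  by rewrite -NSE -map_comp; apply: eq_map => Y /=; rewrite !inE.
split.
  rewrite cat_uniq !map_inj_uniq ?s_enum.1 ?uNS ?andbT /=;
    try by [exact: inl_inj|exact: inr_inj].
  by apply/hasPn => _ /mapP[X _ ->]; apply/negP => /mapP[].
by case=> [v|X]; rewrite mem_cat map_f ?orbT ?s_enum.2.
Qed.

End StateCorrectness.

(** The degree bound [d] grows from round to round, whereas [K] stays fixed: it bounds the degrees
    of the two-level graph only and starts the descent of [N_1]. *)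
Lemma runvE (T : finType) (e : rel T) K fuel d (H : mpgraph) (f : T -> H)
    (s : seq H) (l : seq T) :
  clean_series e f -> enumerates s -> prefix (map f l) s -> 1 < nparts H ->
  (forall x : H, #|nbrs x| <= d) ->
  (nparts H = 2 -> forall x : H, #|nbrs x| <= K) ->
  depth_bounded K H -> K + 3 <= nparts H + fuel ->
  exists (M : mpgraph) (g : T -> M) (s' : seq M),
    [/\ clean_series_end e g, enumerates s', prefix (map g l) s'
      & runv fuel (nparts H) d (state s) = outv (nparts M) (state s')].
Proof.
elim: fuel d H f s => [|fuel IH] d H f s sf se sl H2 degH degK dH KH.
  (* Without fuel, [H] has at least [K + 3] levels. A vertex of a further factorisation would lie in
     a graph with at least [K + 4] levels, against the depth bound. *)
  exists H, f, s; split=> //; split=> //; apply/negP => /set0Pn[X XH].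
  have [||_ _] := depth_bounded_step _ degK dH; rewrite //= ?ltnS //.
  pose u : clean_factor H := inr (exist _ X XH).
  have : u \in part (clean_factor H) (nparts H) by rewrite inE /=.
  move=> uH /(_ u uH); lia.
have [NL [uNL NLE newE]] := newvE se degH.
have [s' [s'e s's extE]] := clean_factor_state se uNL NLE.
rewrite /= newE size_map extE; have [NL0|] := posnP (size NL).
  exists H, f, s; split=> //; split=> //; apply/negP => /set0Pn[X].
  by rewrite -NLE; case: (NL) NL0.
case: NL NLE {uNL newE extE} => // X NL NLE _.
apply: (IH _ (clean_factor H) (fun x => inl (f x))) => //=; try lia.
- apply: clean_series_step => //; apply/set0Pn; exists X.
  by rewrite -NLE mem_head.
- apply: prefix_trans s's; rewrite (map_comp inl f).
  have /prefixP[t ->] := sl; by rewrite map_cat prefix_prefix.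
- exact: degree_bounded_step.
- exact: depth_bounded_step.
Qed.

(** * The initial vertex-clique-incidence graph *)

Section CliqueIncidence.
Variables (T : finType) (e : rel T) (s : seq T).
Hypothesis s_enum : enumerates s.

Definition adjv : seq (seq bool) := [seq [seq e x y | y <- s] | x <- s].

Lemma cliquevE (W : {set T}) : cliquev adjv (bits s W) = clique e W.
Proof.
pose N x := [set y | e x y].
have -> : adjv = [seq bits s (N x) | x <- s].
  by apply: eq_map => x; apply: eq_map => y; rewrite inE.
rewrite /cliquev unitvE // !zip_map2 all_map.
apply/allP/forall_inP => [h x xW|h x _ /=].
  apply/forall_inP => y yW; apply/implyP => xy.
  have /implyP/(_ xW) := h x (s_enum.2 x).
  rewrite /= orvE // subvE // => /subsetP/(_ y yW); rewrite !inE.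
  by rewrite eq_sym (negbTE xy) orbF.
apply/implyP => xW; rewrite orvE // subvE //; apply/subsetP => y yW.
rewrite !inE; have /forall_inP/(_ y yW)/implyP := h x xW.
by case: eqVneq => [_ _|_ /= ->]; rewrite ?orbT.
Qed.

(** Every clique extends to a maximal one and so has at most [c] vertices. The enumeration therefore
    lists all cliques, and its inclusion-maximal members are the maximal cliques. *)
Lemma initvE c : (forall C, C \in max_cliques e -> #|C| <= c) ->
  exists s' : seq (clique_incidence e),
    [/\ enumerates s', prefix (map inl s) s' & initv c adjv = state s'].
Proof.
move=> cP.
have in_max (W : {set T}) : clique e W ->
    exists2 C, C \in max_cliques e & W \subset C.
  by move=> /maxset_exists[C mC WC]; exists C; rewrite // inE.
pose L := [seq W <- small_sets s c | clique e W].
have LE (W : {set T}) : (W \in L) = clique e W.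
  rewrite mem_filter andb_idr // => /in_max[C /cP Cc WC].
  by apply: mem_small_sets => //; apply: leq_trans (subset_leq_card WC) Cc.
have [NL [uNL NLE memNL]] := dedupv_maxvE s_enum L.
have NLmax : NL =i max_cliques e.
  move=> X; rewrite memNL LE inE; apply/andP/maxsetP => -[XL h]; split=> //.
    move=> Y YL XY; apply/eqP; rewrite eqEsubset XY andbT.
    by move/allP: h => /(_ Y); rewrite LE XY; apply.
  by apply/allP => Y; rewrite LE => YL; apply/implyP => /(h Y YL)->.
have cE : cliquesv c adjv = map (bits s) NL.
  rewrite -NLE; congr (dedupv (maxv _)).
  rewrite unitvE // zerovE unionsvE // filter_map; congr map.
  by apply: eq_filter => W; apply: cliquevE.
have [NS NSE [uNS NSall]] := lift_seq uNL NLmax.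
exists (map inl s ++ map inr NS); split; last 2 first.
- by rewrite prefix_prefix.
- rewrite /initv cE.
  have -> : [seq (0, zerov adjv) | _ <- adjv] = [seq (0, bits s set0) | _ <- s].
    by rewrite -map_comp; apply: eq_map => x; rewrite /= zerovE.
  rewrite (@extendvE _ s 1 (fun=> 0) (fun=> set0)) // /state map_cat -!map_comp.
  congr (_ ++ _).
    apply: eq_map => v /=; congr pair; rewrite /bits map_cat -!map_comp.
    congr (_ ++ _); first by apply: eq_map => u /=; rewrite !inE.
    by rewrite -NSE -map_comp; apply: eq_map => X /=; rewrite !inE.
  rewrite -{2}NSE -map_comp; apply: eq_map => X /=; congr pair.
  rewrite /bits map_cat -!map_comp; congr (_ ++ _).
    by apply: eq_map => u /=; rewrite !inE.
  by rewrite -NSE -map_comp; apply: eq_map => Y /=; rewrite !inE.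
split.
  rewrite cat_uniq !map_inj_uniq ?s_enum.1 ?uNS ?andbT /=;
    try by [exact: inl_inj|exact: inr_inj].
  by apply/hasPn => _ /mapP[X _ ->]; apply/negP => /mapP[].
by case=> [v|X]; rewrite mem_cat map_f ?orbT ?s_enum.2.
Qed.

End CliqueIncidence.

Lemma degree_clique_incidence (T : finType) (e : rel T) k c :
  (forall x : T, #|[set C in max_cliques e | x \in C]| <= k) ->
  (forall C : {set T}, C \in max_cliques e -> #|C| <= c) ->
  forall u : clique_incidence e, #|nbrs u| <= maxn k c.
Proof.
move=> kP cP [x|C]; rewrite leq_max; apply/orP; [left|right].
  apply: leq_trans (kP x).
  pose cliques_of := [set C : {C | C \in max_cliques e} | x \in val C].
  apply: (@leq_trans #|(inr : _ -> clique_incidence e) @: cliques_of|).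
    apply: subset_leq_card; apply/subsetP => -[y|C]; rewrite inE //= => xC.
    by apply: imset_f; rewrite inE.
  rewrite card_imset; last exact: inr_inj.
  rewrite -(card_imset _ val_inj); apply: subset_leq_card.
  apply/subsetP => _ /imsetP[C + ->]; rewrite !inE => ->; rewrite andbT.
  by have := valP C; rewrite inE.
apply: leq_trans (cP _ (valP C)).
apply: (@leq_trans #|(inl : _ -> clique_incidence e) @: val C|).
  apply: subset_leq_card; apply/subsetP => -[y|D]; rewrite inE //= => yC.
  exact: imset_f.
by rewrite card_imset //; exact: inl_inj.
Qed.

(** * Encodings of input and output, and the final assembly *)

Lemma outv_represents n (H : mpgraph) (f : 'I_n -> H) (s : seq H) :
  enumerates s -> prefix (map f (enum 'I_n)) s ->
  represents f (enc (outv (nparts H) (state s))).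
Proof.
move=> [us sall] fs; exists s; split=> //.
  by apply: uniq_perm => //; [exact: enum_uniq|move=> x; rewrite mem_enum sall].
congr (Node _ (Node _ _)); first by rewrite /enc /= -!map_comp.
rewrite /enc /= /enc_rel -!map_comp; congr enc_list; apply: eq_map => x /=.
rewrite /enc /= /bits -map_comp; congr enc_list; apply: eq_map => y /=.
by rewrite inE.
Qed.

Lemma enc_adjv (T : finType) (e : rel T) (s : seq T) :
  enc (adjv e s) = enc_rel e s.
Proof.
rewrite /enc_rel /adjv /enc /= -map_comp; congr enc_list.
by apply: eq_map => x /=; rewrite /enc /= -map_comp.
Qed.

Lemma esize_adjv (T : finType) (e : rel T) (s : seq T) :
  esize (adjv e s) <= size s * (size s * 4 + 2) + 1.
Proof.
have row r : List.In r (adjv e s) -> esize r <= size s * 4 + 1.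
  suff rowE t : List.In r [seq [seq e x y | y <- s] | x <- t] -> size r = size s.
    by move/rowE => <-; apply: esize_bits.
  by elim: t => //= x t IH [<-|/IH//]; rewrite size_map.
by have := esize_le_bound row; rewrite size_map -addnS.
Qed.

Theorem mainTheorem5 (k c : nat) (k_gt0 : 0 < k) (c_gt0 : 0 < c) :
  exists (prog : expr) (q : {poly nat}),
  forall (n : nat) (e : rel 'I_n),
    symmetric e -> irreflexive e ->
    (forall x : 'I_n, #|[set C in max_cliques e | x \in C]| <= k) ->
    (forall C : {set 'I_n}, C \in max_cliques e -> #|C| <= c) ->
  exists (M : mpgraph) (f : 'I_n -> M),
    clean_series_end e f /\
    exists (y : tree) (t : nat),
      [/\ computes_in prog (enc_graph e) y t, represents f y & t <= (q.[n])%R].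
Proof.
have [prog [r progP]] := ptime_mainv (maxn k c) c.
(* The argument of [r] bounds the size of an encoded [n] by [n] adjacency matrix, which turns a
   bound in the input size into one in [n]. *)
have [q rq] : poly_bounded (fun n => r.[(n * (n * 4 + 2) + 1)%N]%R) by pbound.
exists prog, q => n e _ _ kP cP.
have en : enumerates (enum 'I_n).
  by split; [exact: enum_uniq|move=> x; rewrite mem_enum].
have [s [se sl initE]] := initvE en cP.
have deg := degree_clique_incidence kP cP.
(* [maxn k c] serves as [K] and as the initial degree bound. The depth invariant is vacuous on two
   levels, and [(maxn k c).+1] rounds give the required [K + 3 <= 2 + K.+1]. *)
have [||M [f [s' [endM s'e s'l runE]]]] :=
    @runvE _ e (maxn k c) (maxn k c).+1 (maxn k c) _ _ s (enum 'I_n)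
      (clean_series_init e) se sl isT deg (fun _ => deg).
- by [].
- by rewrite /= addnS addnC.
exists M, f; split=> //.
have [t ev le_t] := progP (adjv e (enum 'I_n)) [::].
exists (enc (outv (nparts M) (state s'))).
have mainE : mainv (maxn k c) c (adjv e (enum 'I_n)) = outv (nparts M) (state s').
  by rewrite /mainv initE.
rewrite mainE in ev le_t.
eexists; split; [by exists t; [rewrite /enc_graph -enc_adjv; exact: ev|]| |].
  exact: outv_represents.
apply: leq_trans le_t _; apply: leq_trans (rq n).
apply: horner_nat_mono; have := esize_adjv e (enum 'I_n).
by rewrite size_enum_ord.
Qed.
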